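(* Let $H$ be an infinite dimensional complex Hilbert space and let $T$ be a positive bounded linear operator on $H$. Then $T$ is absolutely norm attaining if and only if the following holds: the essential spectrum $\sigma_{ess}(T)$ consists of a single point $\alpha$, and the spectrum $\sigma(T)$ contains only finitely many elements less than $\alpha$.
   Context: A bounded linear operator $T$ on a complex Hilbert space $H$ is called absolutely norm attaining if for every nonzero closed subspace $M$ of $H$ there exists $x_0$ in the unit ball $M_1=\{x\in M : \|x\|\le 1\}$ of $M$ such that $\|Tx_0\|=\sup\{\|Tx\| : x\in M_1\}$. Positive means $\langle Tx,x\rangle\ge 0$ for all $x\in H$. Let $B(H)$ be the algebra of bounded linear operators on $H$, $K(H)$ the ideal of compact operators, and $\mathcal{C}(H)=B(H)/K(H)$ the Calkin algebra with quotient map $\pi$. The essential spectrum $\sigma_{ess}(T)$ is the spectrum of $\pi(T)$ in $\mathcal{C}(H)$. The spectrum $\sigma(T)$ is regarded as a set (elements counted without multiplicity). *)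

(* Defs.v *)
From HB Require Import structures.
From mathcomp Require Import all_boot all_order all_algebra.
From mathcomp Require Import generic_quotient ring_quotient sesquilinear.
From mathcomp Require Import complex.
From mathcomp Require Import all_classical all_reals topology normedtype.

Set Implicit Arguments.
Unset Strict Implicit.
Unset Printing Implicit Defensive.

Import Order.TTheory GRing.Theory Num.Theory.
Import numFieldNormedType.Exports.

Local Open Scope classical_set_scope.
Local Open Scope ring_scope.
Local Open Scope quotient_scope.

Section BoundedOperators.
Variables (K : numFieldType) (V : normedModType K).

Definition unit_ball : set V := [set x | `|x| <= 1].

Definition bounded_linear : {pred V -> V} :=
  [pred f | `[< linear f /\ exists M : K, forall x, `|f x| <= M * `|x| >]].

Lemma bounded_linearP (f : V -> V) :
  reflect (linear f /\ exists M : K, forall x, `|f x| <= M * `|x|)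
          (f \in bounded_linear).
Proof. by rewrite inE; apply: asboolP. Qed.

Lemma bounded_linear_submod : submod_closed bounded_linear.
Proof.
split.
  apply/bounded_linearP; split; first by move=> a x y; rewrite scaler0 addr0.
  by exists 0 => x; rewrite normr0 mul0r.
move=> a f g /bounded_linearP[lf [M fM]] /bounded_linearP[lg [N gN]].
apply/bounded_linearP; split=> [b x y|].
  change (a *: f (b *: x + y) + g (b *: x + y) =
          b *: (a *: f x + g x) + (a *: f y + g y)).
  by rewrite lf lg !scalerDr !scalerA mulrC addrACA.
exists (`|a| * M + N) => x.
rewrite mulrDl -mulrA (le_trans (ler_normD _ _))// lerD// normrZ.
by rewrite ler_wpM2l.
Qed.

HB.instance Definition _ :=
  GRing.isSubmodClosed.Build K (V -> V) bounded_linear bounded_linear_submod.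

Record bop := Bop { bop_val :> V -> V; _ : bop_val \in bounded_linear }.

HB.instance Definition _ := [isSub for bop_val].
HB.instance Definition _ := [Choice of bop by <:].
HB.instance Definition _ := [SubChoice_isSubLmodule of bop by <:].

Lemma bop_linear (T : bop) : linear T.
Proof. by case: T => T /= /bounded_linearP[]. Qed.

HB.instance Definition _ (T : bop) :=
  GRing.isLinear.Build K V V *:%R (bop_val T) (bop_linear T).

Lemma bop_bounded (T : bop) : exists M : K, forall x, `|T x| <= M * `|x|.
Proof. by case: T => T /= /bounded_linearP[]. Qed.

Lemma bop_continuous (T : bop) : continuous T.
Proof.
have [M TM] := bop_bounded T.
apply/linear_bounded_continuous/bounded_funP => r; exists (`|M| * r) => x xr.
rewrite -[leLHS]normr_id (le_trans (y := `|M * `|x| |))//; last first.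
  by rewrite normrM normr_id ler_wpM2l.
by rewrite !ger0_norm ?(le_trans _ (TM x)).
Qed.

Lemma bopP (S T : bop) : (forall x, S x = T x) -> S = T.
Proof. by move=> ST; apply/val_inj/funext. Qed.

Lemma bop_addE (S T : bop) x : (S + T) x = S x + T x. Proof. by []. Qed.
Lemma bop_oppE (T : bop) x : (- T) x = - T x. Proof. by []. Qed.
Lemma bop_scaleE (a : K) (T : bop) x : (a *: T) x = a *: T x.
Proof. by []. Qed.

Lemma bop_id_subproof : id \in bounded_linear.
Proof. by apply/bounded_linearP; split=> //; exists 1 => x; rewrite mul1r. Qed.

Lemma bop_comp_subproof (S T : bop) : S \o T \in bounded_linear.
Proof.
apply/bounded_linearP; split=> [a x y /=|]; first by rewrite !linearP.
have [M SM] := bop_bounded S; have [N TN] := bop_bounded T.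
exists (`|M| * N) => x; rewrite -mulrA (le_trans (SM _))//=.
have M0 : M * `|T x| <= `|M| * `|T x|.
  have := le_trans (normr_ge0 _) (SM (T x)).
  have [->|Tx0] := eqVneq (T x) 0; first by rewrite normr0 !mulr0.
  by rewrite pmulr_lge0 ?normr_gt0// => M0; rewrite ger0_norm.
by rewrite (le_trans M0)// ler_wpM2l.
Qed.

Definition bop_one : bop := Bop bop_id_subproof.
Definition bop_mul (S T : bop) : bop := Bop (bop_comp_subproof S T).

Fact bop_mulA : associative bop_mul. Proof. by move=> R S T; apply: bopP. Qed.
Fact bop_mul1 : left_id bop_one bop_mul. Proof. by move=> T; apply: bopP. Qed.
Fact bop_mulr1 : right_id bop_one bop_mul. Proof. by move=> T; apply: bopP. Qed.
Fact bop_mulDl : left_distributive bop_mul +%R.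
Proof. by move=> R S T; apply: bopP. Qed.
Fact bop_mulDr : right_distributive bop_mul +%R.
Proof. by move=> R S T; apply: bopP => x; exact: (linearD R (S x) (T x)). Qed.

HB.instance Definition _ := GRing.Zmodule_isPzRing.Build bop
  bop_mulA bop_mul1 bop_mulr1 bop_mulDl bop_mulDr.

Lemma bop_mulE (S T : bop) x : (S * T) x = S (T x). Proof. by []. Qed.
Lemma bop_oneE x : (1 : bop) x = x. Proof. by []. Qed.

(* B(V) and B(V)/K(V) can be zero rings, which [algType] excludes; their scalars
   are given by this structure map and its composite with the quotient map. *)
Definition bop_scalar (a : K) : bop := a *: (1 : bop).

Fact bop_scalar_is_zmod_morphism : zmod_morphism bop_scalar.
Proof. by move=> a b; rewrite /bop_scalar scalerBl. Qed.
Fact bop_scalar_is_monoid_morphism : monoid_morphism bop_scalar.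
Proof.
split=> [|a b]; first by rewrite /bop_scalar scale1r.
by apply: bopP => x; rewrite bop_mulE !bop_scaleE !bop_oneE scalerA.
Qed.

HB.instance Definition _ :=
  GRing.isZmodMorphism.Build K bop bop_scalar bop_scalar_is_zmod_morphism.
HB.instance Definition _ :=
  GRing.isMonoidMorphism.Build K bop bop_scalar bop_scalar_is_monoid_morphism.

Definition compact_op : {pred bop} :=
  [pred T | `[< precompact (bop_val T @` unit_ball) >]].

Lemma compact_opP (T : bop) :
  reflect (precompact (T @` unit_ball)) (T \in compact_op).
Proof. by rewrite inE; apply: asboolP. Qed.

Lemma precompact_image (f : V -> V) (A : set V) :
  continuous f -> precompact A -> precompact (f @` A).
Proof.
move=> cf; rewrite precompactE => cA.
have cfA : compact (f @` closure A).
  by apply: continuous_compact => //; apply: continuous_subspaceT.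
exists (f @` closure A); first by apply: image_subset; exact: subset_closure.
by split=> //; apply: compact_closed => //; exact: norm_hausdorff.
Qed.

Lemma precompactD (A B : set V) :
  precompact A -> precompact B -> precompact [set x + y | x in A & y in B].
Proof.
rewrite !precompactE => cA cB.
pose f (z : V * V) := z.1 + z.2.
have cAB : compact (f @` (closure A `*` closure B)).
  apply: continuous_compact; last exact: compact_setX.
  by apply: continuous_subspaceT => z; exact: add_continuous.
rewrite -precompactE; exists (f @` (closure A `*` closure B)).
  move=> _ [x Ax [y By <-]]; exists (x, y) => //.
  by split; exact: subset_closure.
by split=> //; apply: compact_closed => //; exact: norm_hausdorff.
Qed.

Lemma compact_opM (S T : bop) : T \in compact_op -> S * T \in compact_op.
Proof.
move=> /compact_opP cT; apply/compact_opP.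
have -> : (S * T) @` unit_ball = S @` (T @` unit_ball).
  by rewrite -image_comp.
exact: (precompact_image (@bop_continuous S) cT).
Qed.

Lemma compact_opMr (S T : bop) : S \in compact_op -> S * T \in compact_op.
Proof.
move=> /compact_opP cS; apply/compact_opP.
have [M TM] := bop_bounded T.
pose N := `|M| + 1.
have N0 : 0 < N by rewrite ltr_wpDl.
apply: (@precompact_subset _ _ ((fun x => N *: x) @` (S @` unit_ball))).
  move=> _ [x x1 <-]; exists (S (N^-1 *: T x)).
    exists (N^-1 *: T x) => //; rewrite /unit_ball/= normrZ ger0_norm.
      rewrite mulrC ler_pdivrMr// mul1r (le_trans (y := `|M| * `|x|))//.
        rewrite (le_trans (TM x))//.
        have [->|x0] := eqVneq x 0; first by rewrite normr0 !mulr0.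
        have := le_trans (normr_ge0 _) (TM x).
        by rewrite pmulr_lge0 ?normr_gt0// => M0; rewrite ger0_norm.
      rewrite (le_trans (ler_wpM2l (normr_ge0 _) x1))// mulr1.
      by rewrite /N lerDl.
    by rewrite invr_ge0 ltW.
  by rewrite linearZ /= scalerA mulfV ?scale1r// gt_eqF.
by apply: precompact_image => //; exact: scaler_continuous.
Qed.

Fact compact_op_zmod_closed : zmod_closed compact_op.
Proof.
split.
  apply/compact_opP; apply: (@precompact_subset _ _ [set 0]).
    by move=> _ [x _ <-].
  by rewrite precompact_closed; [exact: compact_set1|apply/accessible_closed_set1/hausdorff_accessible; exact: norm_hausdorff].
move=> S T cS /(compact_opM (-1)) /compact_opP cT.
have {}cS := compact_opP _ cS; apply/compact_opP.
apply: precompact_subset (precompactD cS cT) => _ [x x1 <-].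
exists (S x); first by exists x.
by exists (- T x) => //; exists x.
Qed.

HB.instance Definition _ :=
  GRing.isZmodClosed.Build bop compact_op compact_op_zmod_closed.

Definition calkin := Quotient.quot compact_op.

HB.instance Definition _ := GRing.Zmodule.on calkin.

Definition calkin_pi (T : bop) : calkin := \pi_(Quotient.quot compact_op) T.
Definition calkin_repr (x : calkin) : bop :=
  repr (x : Quotient.quot compact_op).

Lemma calkin_reprK : cancel calkin_repr calkin_pi.
Proof. by move=> x; rewrite /calkin_pi /calkin_repr reprK. Qed.

Lemma calkin_piP (S T : bop) :
  reflect (calkin_pi S = calkin_pi T) (S - T \in compact_op).
Proof. by rewrite Quotient.idealrBE; apply: eqP. Qed.

Fact calkin_pi_is_zmod_morphism : zmod_morphism calkin_pi.
Proof.
by move=> S T; rewrite /calkin_pi (@pi_addr _ _ _ _ _ (Quotient.quot compact_op))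
  (@pi_oppr _ _ _ _ _ (Quotient.quot compact_op)).
Qed.

HB.instance Definition _ :=
  GRing.isZmodMorphism.Build bop calkin calkin_pi calkin_pi_is_zmod_morphism.

Definition calkin_mul (x y : calkin) : calkin :=
  calkin_pi (calkin_repr x * calkin_repr y).

Lemma calkin_mul_pi (S T : bop) :
  calkin_mul (calkin_pi S) (calkin_pi T) = calkin_pi (S * T).
Proof.
apply/calkin_piP; set S' := calkin_repr _; set T' := calkin_repr _.
have SS' : S' - S \in compact_op by apply/calkin_piP; exact: calkin_reprK.
have TT' : T' - T \in compact_op by apply/calkin_piP; exact: calkin_reprK.
have -> : S' * T' - S * T = S' * (T' - T) + (S' - S) * T.
  by rewrite mulrBr mulrBl addrA subrK.
by apply: rpredD; [exact: compact_opM|exact: compact_opMr].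
Qed.

Fact calkin_mulA : associative calkin_mul.
Proof.
move=> x y z; rewrite -[x]calkin_reprK -[y]calkin_reprK -[z]calkin_reprK.
by rewrite !calkin_mul_pi mulrA.
Qed.
Fact calkin_mul1 : left_id (calkin_pi 1) calkin_mul.
Proof. by move=> x; rewrite -[x]calkin_reprK calkin_mul_pi mul1r. Qed.
Fact calkin_mulr1 : right_id (calkin_pi 1) calkin_mul.
Proof. by move=> x; rewrite -[x]calkin_reprK calkin_mul_pi mulr1. Qed.
Fact calkin_mulDl : left_distributive calkin_mul +%R.
Proof.
move=> x y z; rewrite -[x]calkin_reprK -[y]calkin_reprK -[z]calkin_reprK.
by rewrite -raddfD !calkin_mul_pi mulrDl raddfD.
Qed.
Fact calkin_mulDr : right_distributive calkin_mul +%R.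
Proof.
move=> x y z; rewrite -[x]calkin_reprK -[y]calkin_reprK -[z]calkin_reprK.
by rewrite -raddfD !calkin_mul_pi mulrDr raddfD.
Qed.

HB.instance Definition _ := GRing.Zmodule_isPzRing.Build calkin
  calkin_mulA calkin_mul1 calkin_mulr1 calkin_mulDl calkin_mulDr.

Fact calkin_pi_is_monoid_morphism : monoid_morphism calkin_pi.
Proof. by split=> // S T; rewrite -calkin_mul_pi. Qed.

HB.instance Definition _ :=
  GRing.isMonoidMorphism.Build bop calkin calkin_pi calkin_pi_is_monoid_morphism.

End BoundedOperators.

Arguments unit_ball {K} V.
Arguments bop {K} V.
Arguments bop_scalar {K} V.
Arguments compact_op {K} V.
Arguments calkin {K} V.

(* iota is the structure map of the unital K-algebra A. *)
Definition spectrum (K A : pzRingType) (iota : {rmorphism K -> A}) (x : A) :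
    set K :=
  [set l | ~ exists y : A, y * (x - iota l) = 1 /\ (x - iota l) * y = 1].

Definition op_spectrum (K : numFieldType) (V : normedModType K) (T : bop V) :
    set K :=
  spectrum (bop_scalar V) T.

Definition ess_spectrum (K : numFieldType) (V : normedModType K) (T : bop V) :
    set K :=
  spectrum (@calkin_pi K V \o bop_scalar V) (calkin_pi T).

Definition finite_dimensional (K : pzRingType) (V : lmodType K) : Prop :=
  exists s : seq V, forall v : V,
    exists a : 'I_(size s) -> K, v = \sum_i a i *: s`_i.

HB.mixin Record CompleteNormedModule_isHilbert (R : realType) (H : Type)
    of CompleteNormedModule R[i] H := {
  inner : {dot H for (@Num.conj R[i])};
  normr_inner : forall x : H, `|x| ^+ 2 = inner x x
}.

#[short(type="hilbertType")]
HB.structure Definition Hilbert (R : realType) :=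
  {H of CompleteNormedModule R[i] H & CompleteNormedModule_isHilbert R H}.

Section HilbertOperators.
Variables (R : realType) (H : hilbertType R).

(* The order of R[i] has 0 <= z exactly when z is real and nonnegative. *)
Definition positive_op (T : bop H) : Prop := forall x, 0 <= inner (T x) x.

(* The norm of H takes its values in R[i]; they are real, and Re reads them in
   R, where [sup] is available. *)
Definition rnorm (x : H) : R := complex.Re `|x|.

Definition absolutely_norm_attaining (T : bop H) : Prop :=
  forall M : set H, submod_closed [in M] -> closed M -> M <> [set 0] ->
    exists2 x0, (M `&` unit_ball H) x0 &
      rnorm (T x0) = sup [set rnorm (T x) | x in M `&` unit_ball H].

End HilbertOperators.

(* Main.v *)
Require Import Defs.
From mathcomp Require Import all_boot all_order all_algebra complex.
From mathcomp Require Import all_classical all_reals topology normedtype.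
From mathcomp Require Import sesquilinear finmap ring lra.

Import Order.TTheory GRing.Theory Num.Theory.
Import numFieldNormedType.Exports.
Local Open Scope classical_set_scope.
Local Open Scope ring_scope.
Local Open Scope complex_scope.

Set Implicit Arguments.
Unset Strict Implicit.
Unset Printing Implicit Defensive.

(** Throughout, [H] is infinite dimensional, [T >= 0] and [A = T^2]; the square of
    [|T x|] is the quadratic form of [A] at [x]. The proof avoids the spectral
    theorem: it compares forms on the spaces [perp G], the complements of finite
    sets [G], which are the closed subspaces of finite codimension. Two facts tie
    them to compactness and to the essential spectrum. A self-adjoint operator
    whose form is small on spaces [perp G] is compact
    ([qform_small_on_perps], [small_on_perps_compact]). The least number [q] that
    bounds the form of a self-adjoint [S] from above, up to arbitrarily small
    errors, in finite codimension ([ess_upper]) belongs to its essential spectrum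
    ([ess_upper_approx_kernel], [approx_kernel_not_unit]). Moreover, a compact
    self-adjoint form that is positive somewhere on a closed subspace attains the
    maximum of its quotient by [|x|^2] there ([compact_maximizer]).

    Let [T] be absolutely norm attaining, and [q] the upper essential bound of [A].
    If the form of [A] took values below [q |x|^2] in every [perp G], one could
    choose successively vectors [z_n], orthogonal to each other and to the [A z_m],
    whose quotients increase strictly ([intermediate_quotient]). On the closed span
    of the [z_n] the norm of [T] is not attained ([no_increasing_sequence]). So the
    form of [A] is at least [q |x|^2] on some [perp G]; hence [A - q] is compact,
    and so is [T - a], where [a] is the square root of [q]. Then [a] is the only
    point of the essential spectrum. Points of the spectrum below [a] are
    eigenvalues ([op_spectrum_eigenvalue]), and there are at most [size G] of them,
    since a combination of more eigenvectors can be chosen in [perp G], where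
    [a |x| <= |T x|] ([finite_spectrum_below]).

    Conversely, if the essential spectrum of [T] is a single point [a], then the
    upper essential bounds of [T] and [- T] are [a] and [- a], so [T - a] is
    compact ([ess_spectrum1_compact]). Finitely many points of the spectrum below
    [a], each with a finite-dimensional eigenspace, yield [G] such that [T >= a] on
    [perp G] ([qform_ge_on_perp]). A closed subspace that meets [perp G] has
    quotients at least [a^2], and a larger supremum is a maximum because [A - a^2]
    is compact; a closed subspace that does not is finite dimensional
    ([compact_perturbation_has_maximizers]). *)

(** * The real part of the inner product *)

Section RealForm.
Variables (R : realType) (H : hilbertType R).
Implicit Types (x y z g : H) (S T K : bop H) (G : seq H) (M : set H).

(** All estimates are made with the real bilinear form [rip], whose values are
    totally ordered; complex orthogonality is kept where subspaces are involved. *)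
Definition rip x y : R := complex.Re (inner x y).
Definition qform S x : R := rip (S x) x.
Definition nrm2 x : R := rip x x.

Lemma innerC x y : inner x y = conjc (inner y x).
Proof. by have := hermC (@inner R H) x y; rewrite expr0 mul1r => ->. Qed.
Lemma innerDl x y z : inner (x + y) z = inner x z + inner y z.
Proof. exact: linearDl. Qed.
Lemma innerDr x y z : inner x (y + z) = inner x y + inner x z.
Proof. exact: linearDr. Qed.
Lemma innerNl x y : inner (- x) y = - inner x y.
Proof. exact: linearNl. Qed.
Lemma innerBl x y z : inner (x - y) z = inner x z - inner y z.
Proof. exact: linearBl. Qed.
Lemma innerBr x y z : inner x (y - z) = inner x y - inner x z.
Proof. exact: linearBr. Qed.
Lemma innerZl a x y : inner (a *: x) y = a * inner x y.
Proof. exact: linearZl_LR. Qed.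
Lemma innerZr a x y : inner x (a *: y) = conjc a * inner x y.
Proof. exact: linearZr_LR. Qed.
Lemma inner0l x : inner 0 x = 0. Proof. exact: linear0l. Qed.
Lemma inner0r x : inner x 0 = 0. Proof. exact: linear0r. Qed.

Lemma ripC x y : rip x y = rip y x.
Proof. by rewrite /rip innerC; case: (inner y x). Qed.
Lemma ripDl x y z : rip (x + y) z = rip x z + rip y z.
Proof. by rewrite /rip innerDl raddfD. Qed.
Lemma ripNl x y : rip (- x) y = - rip x y.
Proof. by rewrite /rip innerNl raddfN. Qed.
Lemma ripZl (a : R) x y : rip (a%:C *: x) y = a * rip x y.
Proof. by rewrite /rip innerZl; case: (inner x y) => u v /=; rewrite mul0r subr0. Qed.
Lemma ripDr x y z : rip x (y + z) = rip x y + rip x z.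
Proof. by rewrite !(ripC x) ripDl. Qed.
Lemma ripNr x y : rip x (- y) = - rip x y.
Proof. by rewrite !(ripC x) ripNl. Qed.
Lemma ripZr (a : R) x y : rip x (a%:C *: y) = a * rip x y.
Proof. by rewrite !(ripC x) ripZl. Qed.
Lemma rip0l x : rip 0 x = 0. Proof. by rewrite /rip inner0l. Qed.
Lemma rip0r x : rip x 0 = 0. Proof. by rewrite /rip inner0r. Qed.

Definition ripE := (ripDl, ripDr, ripNl, ripNr, ripZl, ripZr).

Lemma inner0_rip x y : inner x y = 0 -> rip x y = 0.
Proof. by rewrite /rip => ->. Qed.

(** The real part of the inner product sees the imaginary part as well, after
    a rotation by [i] of the second argument. *)
Lemma rip_inner0 x y : rip x y = 0 -> rip x ('i *: y) = 0 -> inner x y = 0.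
Proof.
rewrite /rip innerZr; case: (inner x y) => u v /= ->.
by rewrite mul0r sub0r mulN1r opprK => ->.
Qed.

Lemma nrm2_rnorm x : nrm2 x = rnorm x ^+ 2.
Proof.
have xr : (rnorm x)%:C = `|x| by rewrite RRe_real ?ger0_real.
by rewrite /nrm2 /rip -normr_inner -xr -rmorphXn.
Qed.

Lemma nrm2_ge0 x : 0 <= nrm2 x.
Proof. by rewrite nrm2_rnorm sqr_ge0. Qed.

Lemma rnorm_ge0 x : 0 <= rnorm x.
Proof. by rewrite -ler0c /rnorm RRe_real ?ger0_real. Qed.

Lemma rnorm_sqrt x : rnorm x = Num.sqrt (nrm2 x).
Proof. by rewrite nrm2_rnorm sqrtr_sqr ger0_norm ?rnorm_ge0. Qed.

Lemma norm_rip x : `|x| = (Num.sqrt (nrm2 x))%:C.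
Proof. by rewrite -rnorm_sqrt RRe_real ?ger0_real. Qed.

Lemma inner_nrm2 x : inner x x = (nrm2 x)%:C.
Proof.
by rewrite -normr_inner norm_rip -rmorphXn/= sqr_sqrtr ?nrm2_ge0.
Qed.

Lemma nrm2_eq0 x : nrm2 x = 0 -> x = 0.
Proof. by move=> x0; apply/normr0_eq0; rewrite norm_rip x0 sqrtr0. Qed.

Lemma nrm2_gt0 x : x <> 0 -> 0 < nrm2 x.
Proof.
by move=> x0; rewrite lt_neqAle nrm2_ge0 andbT eq_sym; apply/eqP => /nrm2_eq0.
Qed.

Lemma nrm20 : nrm2 0 = 0. Proof. exact: rip0l. Qed.

Lemma nrm2Z (a : R) x : nrm2 (a%:C *: x) = a ^+ 2 * nrm2 x.
Proof. by rewrite /nrm2 !ripE mulrA. Qed.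

Lemma nrm2Zc (a : R[i]) x : nrm2 (a *: x) = complex.Re (`|a| ^+ 2) * nrm2 x.
Proof.
rewrite /nrm2 {1}/rip innerZl innerZr mulrA -sqr_normc inner_nrm2 normc_def.
by rewrite -rmorphXn -rmorphM.
Qed.

Lemma nrm2N x : nrm2 (- x) = nrm2 x.
Proof. by rewrite /nrm2 !ripE opprK. Qed.

Lemma nrm2D_le x y : nrm2 (x + y) <= 2 * nrm2 x + 2 * nrm2 y.
Proof. by have := nrm2_ge0 (x - y); rewrite /nrm2 !ripE (ripC y x); lra. Qed.

Lemma nrm2B_le x y : nrm2 (x - y) <= 2 * nrm2 x + 2 * nrm2 y.
Proof. by have := nrm2D_le x (- y); rewrite nrm2N. Qed.

(** * Subspaces and orthogonal complements *)

Definition subspace M := submod_closed [in M].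

Lemma subspaceP M : subspace M <->
  M 0 /\ forall a x y, M x -> M y -> M (a *: x + y).
Proof.
split=> -[M0 ML]; split; first by move: M0; rewrite in_setE.
- by move=> a x y Mx My; have := ML a x y; rewrite !in_setE; apply.
- by rewrite in_setE.
- by move=> a x y; rewrite !in_setE; exact: ML.
Qed.

Lemma subspace0 M : subspace M -> M 0. Proof. by move=> /subspaceP[]. Qed.
Lemma subspaceZ M a x : subspace M -> M x -> M (a *: x).
Proof. by move=> /subspaceP[M0 ML] Mx; rewrite -[_ *: _]addr0; exact: ML. Qed.
Lemma subspaceD M x y : subspace M -> M x -> M y -> M (x + y).
Proof. by move=> /subspaceP[M0 ML] Mx; rewrite -[x]scale1r; exact: ML. Qed.
Lemma subspaceB M x y : subspace M -> M x -> M y -> M (x - y).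
Proof.
by move=> sM Mx My; rewrite -scaleN1r; apply: subspaceD => //; apply: subspaceZ.
Qed.

Lemma subspaceT : subspace (@setT H). Proof. exact/subspaceP. Qed.

Lemma subspaceI M M' : subspace M -> subspace M' -> subspace (M `&` M').
Proof.
move=> /subspaceP[M0 ML] /subspaceP[M0' ML']; apply/subspaceP; split=> //.
by move=> a x y [? ?] [? ?]; split; [exact: ML|exact: ML'].
Qed.

(** For a closed subspace generated by [A], [orth (orth A)] serves as the closed
    linear span, with the membership property it is used for built in. *)
Definition orth (A : set H) : set H := [set x | forall y, A y -> inner x y = 0].
(** The spaces [perp G], for finite [G], play the role of the closed subspaces
    of finite codimension. *)
Definition perp G : set H := orth [set` G].

Lemma perp_cons g G x : perp (g :: G) x <-> inner x g = 0 /\ perp G x.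
Proof.
split=> [xG|[xg xG] y/=]; last by rewrite in_cons => /orP[/eqP->|/xG].
by split=> [|y yG]; apply: xG; rewrite /= in_cons ?eqxx// yG orbT.
Qed.

Lemma perp_cat G G' x : perp (G ++ G') x <-> perp G x /\ perp G' x.
Proof.
split=> [xG|[xG xG'] y/=]; last by rewrite mem_cat => /orP[/xG|/xG'].
by split=> y yG; apply: xG; rewrite /= mem_cat yG ?orbT.
Qed.

Lemma orth_subspace (A : set H) : subspace (orth A).
Proof.
apply/subspaceP; split=> [y _|a x y Ax Ay z Az]; first exact: inner0l.
by rewrite innerDl innerZl Ax// Ay// mulr0 addr0.
Qed.

Lemma perp_subspace G : subspace (perp G). Proof. exact: orth_subspace. Qed.

(** * Operators and their quadratic forms *)

Lemma bopD S x y : S (x + y) = S x + S y. Proof. exact: raddfD. Qed.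
Lemma bopB S x y : S (x - y) = S x - S y. Proof. exact: raddfB. Qed.
Lemma bopN S x : S (- x) = - S x. Proof. exact: raddfN. Qed.
Lemma bop0 S : S 0 = 0. Proof. exact: raddf0. Qed.
Lemma bopZ S a x : S (a *: x) = a *: S x. Proof. exact: linearZ. Qed.

Definition selfadjoint S := forall x y, inner (S x) y = inner x (S y).

Lemma selfadjoint_rip S x y : selfadjoint S -> rip (S x) y = rip x (S y).
Proof. by rewrite /rip => ->. Qed.

Lemma selfadjoint_perp S G x :
  selfadjoint S -> perp (map S G) x -> perp G (S x).
Proof. by move=> sS xG g gG; rewrite sS xG//=; apply: map_f. Qed.

Definition scal (c : R) : bop H := bop_scalar H c%:C.

Lemma scalE c x : scal c x = c%:C *: x. Proof. by []. Qed.

Lemma selfadjoint_scal c : selfadjoint (scal c).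
Proof.
by move=> x y; rewrite !scalE innerZl innerZr conjc_real.
Qed.
Lemma selfadjoint1 : selfadjoint 1. Proof. by []. Qed.
Lemma selfadjointD S T : selfadjoint S -> selfadjoint T -> selfadjoint (S + T).
Proof. by move=> sS sT x y; rewrite !bop_addE innerDl innerDr sS sT. Qed.
Lemma selfadjointN S : selfadjoint S -> selfadjoint (- S).
Proof. by move=> sS x y; rewrite !bop_oppE innerNl sS; exact/esym/linearNr. Qed.
Lemma selfadjointB S T : selfadjoint S -> selfadjoint T -> selfadjoint (S - T).
Proof. by move=> sS sT; apply: selfadjointD => //; apply: selfadjointN. Qed.
Lemma selfadjoint_sqr S : selfadjoint S -> selfadjoint (S * S).
Proof. by move=> sS x y; rewrite !bop_mulE !sS. Qed.

Lemma qformD S T x : qform (S + T) x = qform S x + qform T x.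
Proof. by rewrite /qform bop_addE ripE. Qed.
Lemma qformN S x : qform (- S) x = - qform S x.
Proof. by rewrite /qform bop_oppE ripE. Qed.
Lemma qformB S T x : qform (S - T) x = qform S x - qform T x.
Proof. by rewrite qformD qformN. Qed.
Lemma qform_scal c x : qform (scal c) x = c * nrm2 x.
Proof. by rewrite /qform ripE. Qed.
Lemma qform_sqr S x : selfadjoint S -> qform (S * S) x = nrm2 (S x).
Proof. by move=> sS; rewrite /qform bop_mulE selfadjoint_rip. Qed.
Lemma qformZ S (a : R) x : qform S (a%:C *: x) = a ^+ 2 * qform S x.
Proof. by rewrite /qform bopZ !ripE mulrA. Qed.
Lemma qform0 S : qform S 0 = 0.
Proof. by rewrite /qform rip0r. Qed.
Lemma qform_add S x y : selfadjoint S ->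
  qform S (x + y) = qform S x + 2 * rip (S x) y + qform S y.
Proof.
move=> sS; rewrite /qform bopD !ripE (selfadjoint_rip y x sS) (ripC y).
by lra.
Qed.

(** Over the complex numbers, positivity forces self-adjointness: the
    quadratic form is real and polarization recovers the sesquilinear form. *)
Lemma positive_selfadjoint T : positive_op T -> selfadjoint T.
Proof.
move=> pT.
have ImT z : complex.Im (inner (T z) z) = 0 by exact/ger0_Im/pT.
have Imp x y : complex.Im (inner (T x) y) = - complex.Im (inner (T y) x).
  have := ImT (x + y); rewrite bopD !innerDl !innerDr !raddfD /= !ImT.
  by lra.
move=> x y; have := Imp x y; have := Imp x ('i *: y).
rewrite bopZ innerZl innerZr (innerC x).
case: (inner (T x) y) => a b; case: (inner (T y) x) => c d /=.
rewrite !(mul0r, mul1r, mulN1r, add0r, addr0, subr0) => ac bd.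
by apply/eqP; rewrite eq_complex/=; apply/andP; split; apply/eqP; lra.
Qed.

Lemma discriminant (a b c : R) : 0 <= c ->
  (forall t, 0 <= a + 2 * t * b + t ^+ 2 * c) -> b ^+ 2 <= a * c.
Proof.
move=> c0 abc; have [ce0|cn0] := eqVneq c 0.
  rewrite ce0 mulr0; have [->|b0] := eqVneq b 0; first by rewrite expr0n.
  (* With [c = 0] the expression is affine in [t]; here it takes the value -1. *)
  have := abc (- (a + 1) / (2 * b)); rewrite ce0 !mulr0 addr0.
  have -> : 2 * (- (a + 1) / (2 * b)) * b = - (a + 1) by field.
  by lra.
have cp : 0 < c by rewrite lt_neqAle eq_sym cn0.
(* [- b / c] is the minimum of the parabola. *)
have := abc (- b / c).
have -> : a + 2 * (- b / c) * b + (- b / c) ^+ 2 * c = (a * c - b ^+ 2) / c.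
  by field.
by rewrite pmulr_lge0 ?invr_gt0// subr_ge0.
Qed.

(** Cauchy-Schwarz for a form that is only known to be nonnegative on a
    subspace: [t |-> qform B (x + t y)] has a nonpositive discriminant. *)
Lemma cauchy_schwarz_on M B x y : subspace M -> selfadjoint B ->
  (forall z, M z -> 0 <= qform B z) -> M x -> M y ->
  rip (B x) y ^+ 2 <= qform B x * qform B y.
Proof.
move=> sM sB B0 Mx My.
have Bt (t : R) : 0 <= qform B x + 2 * t * rip (B x) y + t ^+ 2 * qform B y.
  have : 0 <= qform B (x + t%:C *: y).
    by apply: B0; apply: subspaceD => //; apply: subspaceZ.
  by rewrite qform_add// qformZ ripZr; lra.
by apply: discriminant => //; exact: B0.
Qed.

Lemma rip_cauchy_schwarz x y : rip x y ^+ 2 <= nrm2 x * nrm2 y.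
Proof.
exact: (cauchy_schwarz_on subspaceT selfadjoint1 (fun z _ => nrm2_ge0 z)).
Qed.

(** By Cauchy-Schwarz the value of the form at [x] controls its derivative there,
    so a zero of a form that is nonnegative on [M] is a critical point. *)
Lemma qform0_orth M B x : subspace M -> selfadjoint B ->
  (forall z, M z -> 0 <= qform B z) -> M x -> qform B x = 0 ->
  forall y, M y -> inner (B x) y = 0.
Proof.
move=> sM sB B0 Mx Bx y My.
have crit z : M z -> rip (B x) z = 0.
  move=> Mz; have := cauchy_schwarz_on sM sB B0 Mx Mz.
  by rewrite Bx mul0r => h; apply/eqP; rewrite -sqrf_eq0 eq_le h sqr_ge0.
by apply: rip_inner0; apply: crit => //; apply: subspaceZ.
Qed.

Lemma qformBD S x y : selfadjoint S ->
  qform S (x + y) + qform S (x - y) = 2 * qform S x + 2 * qform S y.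
Proof.
move=> sS; rewrite !qform_add// ripNr /qform !bopN !ripE; lra.
Qed.

Lemma nrm2_bound S : exists2 C : R, 0 < C & forall x, nrm2 (S x) <= C * nrm2 x.
Proof.
have [[m m'] SM] := bop_bounded S.
exists (m ^+ 2 + 1) => [|x]; first by nra.
have := SM x; rewrite !norm_rip lecE/= => /andP[_].
rewrite mulr0 subr0 => h.
rewrite -(sqr_sqrtr (nrm2_ge0 (S x))) -(sqr_sqrtr (nrm2_ge0 x)).
have := sqrtr_ge0 (nrm2 (S x)); have := sqrtr_ge0 (nrm2 x).
move: h; move: (Num.sqrt _) (Num.sqrt _) => a b ab b0 a0.
by nra.
Qed.

Lemma qform_bound S : exists2 C : R, 0 < C & forall x, qform S x <= C * nrm2 x.
Proof.
have [C C0 SC] := nrm2_bound S; exists (C + 1) => [|x]; first by lra.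
have := nrm2_ge0 (S x - x); have := SC x; have := mulr_ge0 (ltW C0) (nrm2_ge0 x).
have := nrm2_ge0 x.
by rewrite /qform /nrm2 !ripE (ripC x (S x)); lra.
Qed.

End RealForm.

(** * Topology of a Hilbert space in terms of squared distances *)

Section Topology.
Variables (R : realType) (H : hilbertType R).
Implicit Types (x y z g : H) (S T K : bop H) (G : seq H) (M : set H).

Lemma norm_lt_nrm2 x (e : R) : 0 < e -> (`|x| < e%:C) = (nrm2 x < e ^+ 2).
Proof.
move=> e0; rewrite norm_rip ltcR -(ltr_sqr (sqrtr_ge0 _) (ltW e0)).
by rewrite sqr_sqrtr// nrm2_ge0.
Qed.

Lemma norm_le1_nrm2 x : unit_ball H x <-> nrm2 x <= 1.
Proof.
rewrite /unit_ball/= norm_rip -[1]/(1%:C) lecR.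
by rewrite -{1}sqrtr1 ler_sqrt// ltr01.
Qed.

(** The balls of [H] have radii in [R[i]]; squared real distances give the same
    neighborhoods. *)
Lemma ball_nrm2 (r : R[i]) : 0 < r ->
  exists2 e : R, 0 < e & forall x, ball x r = [set y | nrm2 (x - y) < e].
Proof.
case: r => r r'; rewrite ltcE/= => /andP[/eqP -> r0].
exists (r ^+ 2); first by rewrite exprn_gt0.
by move=> x; apply/seteqP; split=> y; rewrite -ball_normE/= -norm_lt_nrm2.
Qed.

Lemma nrm2_ball x (e : R) : 0 < e ->
  exists2 r : R[i], 0 < r & ball x r `<=` [set y | nrm2 (x - y) < e].
Proof.
move=> e0; exists (Num.sqrt e)%:C; first by rewrite ltcR sqrtr_gt0.
move=> y; rewrite -ball_normE/= norm_lt_nrm2 ?sqrtr_gt0// sqr_sqrtr//.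
exact: ltW.
Qed.

Lemma nbhs_nrm2 x (A : set H) : nbhs x A <->
  exists2 e : R, 0 < e & [set y | nrm2 (x - y) < e] `<=` A.
Proof.
split=> [/nbhs_ballP[r /= /ball_nrm2[e e0 ->] rA]|[e e0 eA]]; first by exists e.
have [r r0 re] := nrm2_ball x e0.
by apply/nbhs_ballP; exists r => //; exact: subset_trans re eA.
Qed.

Lemma complete_nrm2 (F : set_system H) : ProperFilter F ->
  (forall e : R, 0 < e -> exists x, F [set y | nrm2 (x - y) < e]) ->
  exists l, forall e : R, 0 < e -> F [set y | nrm2 (l - y) < e].
Proof.
move=> FF Fc; have /cauchy_cvg Fl : cauchy F.
  apply: cauchy_exP => r /ball_nrm2[e e0 re]; have [x Fx] := Fc _ e0.
  by exists x; rewrite re.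
exists (lim F) => e e0; apply: Fl; apply/nbhs_nrm2.
by exists e.
Qed.

Lemma closed_nrm2 M : closed M <->
  forall l, (forall e : R, 0 < e -> exists2 x, M x & nrm2 (l - x) < e) -> M l.
Proof.
split=> [cM l Ml|Ml l cl].
  apply: cM => B /nbhs_nrm2[e e0 eB]; have [x Mx lx] := Ml _ e0.
  by exists x; split=> //; exact: eB.
apply: Ml => e e0; have [|x [Mx lx]] := cl [set y | nrm2 (l - y) < e].
  by apply/nbhs_nrm2; exists e.
by exists x.
Qed.

(** [inner l y] is the limit of the null values [inner x y]; by Cauchy-Schwarz
    the difference is controlled by [nrm2 (l - x)]. *)
Lemma closed_orth (A : set H) : closed (orth A).
Proof.
apply/closed_nrm2 => l Al y Ay.
have rl z : (forall x, orth A x -> rip x z = 0) -> rip l z = 0.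
  move=> Az; apply/eqP; rewrite -sqrf_eq0 eq_le sqr_ge0 andbT.
  apply/ler_addgt0Pr => e e0; rewrite add0r.
  have [|x Ax lx] := Al (e / (nrm2 z + 1)).
    by rewrite divr_gt0// ltr_wpDl// nrm2_ge0.
  have := rip_cauchy_schwarz (l - x) z; rewrite ripDl ripNl (Az _ Ax) subr0.
  move=> /le_trans; apply; move: lx; rewrite ltr_pdivlMr ?ltr_wpDl ?nrm2_ge0//.
  by have := nrm2_ge0 (l - x); have := nrm2_ge0 z; nra.
apply: rip_inner0; apply: rl => x /(_ y Ay) xy; apply: inner0_rip => //.
by rewrite innerZr xy mulr0.
Qed.

(** Used with sets [A d] of vectors that are extremal up to [d]: a limit of the
    ultrafilter is then extremal, and no subsequence has to be extracted. *)
Lemma ultrafilter_of (A : R -> set H) :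
  (forall d, 0 < d -> A d !=set0) ->
  (forall d d', d <= d' -> A d `<=` A d') ->
  exists2 U : set_system H, UltraFilter U & forall d, 0 < d -> U (A d).
Proof.
move=> A0 Ad; pose F := filter_from [set d : R | 0 < d] A.
have FF : ProperFilter F.
  apply: filter_from_proper; last by move=> d; exact: A0.
  apply: filter_from_filter; first by exists 1; exact: ltr01.
  move=> i j /= i0 j0; exists (Num.min i j); first by rewrite /= lt_min i0.
  by move=> x Ax; split; apply: Ad Ax; rewrite ge_min lexx ?orbT.
have [U [UU FU]] := ultraFilterLemma FF.
by exists U => // d d0; apply: FU; exists d.
Qed.

(** This turns a finite net of a member of an ultrafilter into one small member,
    which is how total boundedness makes an ultrafilter Cauchy. *)
Lemma ultra_seq (T : Type) (U : set_system T) (I : eqType) (s : seq I)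
    (A : I -> set T) :
  UltraFilter U -> U [set x | exists2 i, i \in s & A i x] ->
  exists2 i, i \in s & U (A i).
Proof.
move=> UU; elim: s => [|i s IH] Us.
  have [|x [] //] := @filter_ex _ U _ [set x | exists2 i, i \in [::] & A i x].
  exact: Us.
have [Ai|Ai] := in_ultra_setVsetC (A i) UU; first by exists i; rewrite ?mem_head.
have [|j js Aj] := IH; last by exists j => //; rewrite inE js orbT.
apply: filterS (filterI Us Ai) => x [[j +] Ajx nAi]; rewrite inE => /orP[/eqP ji|js].
  by move: Ajx nAi; rewrite ji.
by exists j.
Qed.

(** Total boundedness of the image of the unit ball, which by completeness is
    the same as its relative compactness. *)
Definition finite_nets (f : H -> H) : Prop := forall e : R, 0 < e ->
  exists G : seq H, forall x, nrm2 x <= 1 -> exists2 g, g \in G & nrm2 (g - f x) < e.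

Lemma compact_op_nets K : K \in compact_op H -> finite_nets K.
Proof.
move=> /compact_opP; rewrite precompactE compact_cover => cK e e0.
have [] := cK H setT (fun g => interior [set y | nrm2 (g - y) < e]).
- by move=> g _; exact: open_interior.
- move=> y _; exists y => //; apply/nbhs_nrm2; exists e => //.
move=> G _ GK; exists (enum_fset G) => x x1.
have [|g /= gG] := GK (K x).
  by apply: subset_closure; exists x => //; apply/norm_le1_nrm2.
by move=> /interior_subset gx; exists g.
Qed.

Lemma nets_compact_op K : finite_nets K -> K \in compact_op H.
Proof.
move=> nK; apply/compact_opP; rewrite precompactE compact_ultra => U UU UK.
have [] := @complete_nrm2 U _.
  move=> e e0; have [|G GK] := nK (e / 4); first by rewrite divr_gt0.
  have [|g _ Ug] := @ultra_seq _ U _ G (fun g => [set y | nrm2 (g - y) < e]) UU.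
    apply: filterS UK => y cy.
    have [|z [[x /norm_le1_nrm2 x1 <-] yx]] :=
      cy [set z | nrm2 (y - z) < e / 4].
      by apply/nbhs_nrm2; exists (e / 4) => //; rewrite divr_gt0.
    have [g gG gx] := GK _ x1; exists g => //=.
    rewrite -[g - y]/(g + - y) -(subrK (K x) g) -addrA.
    apply: le_lt_trans (nrm2D_le _ _) _.
    rewrite -[K x - y]opprB nrm2N.
    by move: yx gx => /=; lra.
  by exists g.
move=> l Ul; exists l; split; last first.
  move=> B /= /nbhs_nrm2[e e0 eB]; exact: filterS eB (Ul _ e0).
apply: closed_closure => B /nbhs_nrm2[e e0 eB].
have [y [cy ly]] := filter_ex (filterI UK (Ul _ e0)).
by exists y; split=> //; exact: eB.
Qed.

End Topology.

(** * Projections off finite sets and compact operators *)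

Section Projections.
Variables (R : realType) (H : hilbertType R).
Implicit Types (x y z g e : H) (S T K P : bop H) (G : seq H) (M E : set H).

Lemma nrm2_scale (a : R[i]) x :
  nrm2 (a *: x) = (complex.Re a ^+ 2 + complex.Im a ^+ 2) * nrm2 x.
Proof. by rewrite nrm2Zc -add_Re2_Im2. Qed.

Lemma normalize x : x <> 0 -> exists2 a : R, a != 0 & nrm2 (a%:C *: x) = 1.
Proof.
move=> /nrm2_gt0 x0; exists (Num.sqrt (nrm2 x))^-1.
  by rewrite invr_neq0// gt_eqF// sqrtr_gt0.
by rewrite nrm2Z exprVn sqr_sqrtr ?ltW// mulVf// gt_eqF.
Qed.

Lemma inner_bound x y :
  complex.Re (inner x y) ^+ 2 <= nrm2 x * nrm2 y /\
  complex.Im (inner x y) ^+ 2 <= nrm2 x * nrm2 y.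
Proof.
split; first exact: rip_cauchy_schwarz.
have := rip_cauchy_schwarz x ('i *: y).
rewrite nrm2_scale /= expr0n/= expr1n add0r mul1r; apply: le_trans.
rewrite /rip innerZr; case: (inner x y) => a b /=.
by rewrite !(mul0r, mulN1r, sub0r, opprK).
Qed.

Lemma bounded_linear_nrm2 (f : H -> H) (C : R) :
  linear f -> (forall x, nrm2 (f x) <= C * nrm2 x) -> f \in @bounded_linear _ H.
Proof.
move=> lf fC; apply/bounded_linearP; split=> //.
exists (Num.sqrt (`|C|))%:C => x.
rewrite !norm_rip -rmorphM/= lecR -sqrtrM// ler_wsqrtr//.
by rewrite (le_trans (fC x))// ler_wpM2r ?nrm2_ge0// ler_norm.
Qed.

Lemma rank_one_bounded e : (fun x => inner x e *: e) \in @bounded_linear _ H.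
Proof.
apply: (@bounded_linear_nrm2 _ (2 * nrm2 e ^+ 2)) => [a x y|x].
  by rewrite innerDl innerZl scalerDl scalerA.
have [] := inner_bound x e; rewrite nrm2_scale.
by move: (nrm2_ge0 e) (nrm2_ge0 x); nra.
Qed.

Definition rank_one e : bop H := Bop (rank_one_bounded e).

Lemma rank_oneE e x : rank_one e x = inner x e *: e. Proof. by []. Qed.

(** Total boundedness of real intervals: round [a] down to the grid of mesh [c]
    starting at [- b]. *)
Lemma grid (B d : R) : 0 < d ->
  exists L : seq R, forall a : R, a ^+ 2 <= B -> exists2 l, l \in L & (l - a) ^+ 2 < d.
Proof.
move=> d0.
(* [c] is chosen with [c ^+ 2 < d], [b] with [a ^+ 2 <= B -> `|a| <= b]. *)
pose b := `|B| + 1; pose c := d / (d + 1).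
have b0 : 1 <= b by rewrite lerDr.
have c0 : 0 < c by rewrite divr_gt0// addr_gt0.
exists [seq - b + c * k%:R | k <- iota 0 (Num.truncn (2 * b / c)).+1] => a aB.
have ab : - b <= a <= b.
  have a1 : a <= a ^+ 2 + 1 by nra.
  have a2 : - a <= a ^+ 2 + 1 by nra.
  have BB := ler_norm B.
  by apply/andP; rewrite /b; split; lra.
have [ab1 ab2] := andP ab.
have ac0 : 0 <= (a + b) / c by apply: divr_ge0; [lra|exact: ltW].
have := truncn_itv ac0; set k := Num.truncn _ => /andP[k1 k2].
exists (- b + c * k%:R).
  apply/mapP; exists k => //; rewrite mem_iota add0n ltnS.
  by apply: le_truncn; rewrite ler_pM2r ?invr_gt0 //; lra.
move: k1 k2; rewrite ler_pdivlMr// ltr_pdivrMr// -natr1 => k1 k2.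
have cd : c ^+ 2 < d.
  have dc : d = c * (d + 1) by rewrite mulfVK// gt_eqF// addr_gt0.
  have c1 : c < 1 by rewrite ltr_pdivrMr ?addr_gt0//; lra.
  by rewrite [X in _ < X]dc; nra.
apply: le_lt_trans cd; nra.
Qed.

(** The image of the unit ball is a bounded piece of a complex line; a grid for
    the real and imaginary parts of the coordinate gives the nets. *)
Lemma compact_rank_one e : rank_one e \in compact_op H.
Proof.
apply: nets_compact_op => d d0.
have e0 := nrm2_ge0 e.
have [|L LP] := grid (nrm2 e) (d := d / (2 * (nrm2 e + 1))).
  by rewrite divr_gt0//; lra.
exists [seq (l +i* l') *: e | l <- L, l' <- L] => x x1.
have [re ie] := inner_bound x e.
have [|l lL la] := LP (complex.Re (inner x e)); first by nra.
have [|l' lL' la'] := LP (complex.Im (inner x e)); first by nra.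
exists ((l +i* l') *: e); first exact: allpairs_f.
rewrite rank_oneE -scalerBl nrm2_scale.
move: la la'; case: (inner x e) => a b /=.
rewrite !ltr_pdivlMr; [|by lra|by lra].
have := sqr_ge0 (l - a); have := sqr_ge0 (l' - b).
move: ((l - a) ^+ 2) ((l' - b) ^+ 2) => u v; nra.
Qed.

(** The orthogonal projection onto the complement of finitely many vectors is
    built by removing one vector at a time (Gram-Schmidt); each step changes it
    by a rank-one operator. *)
Lemma perp_projection G : exists P, [/\ selfadjoint P, forall x, P (P x) = P x,
  forall x, perp G (P x), forall x, perp G x -> P x = x & 1 - P \in compact_op H].
Proof.
elim: G => [|g G [P [sP PP PG GP cP]]].
  by exists 1; split=> //; rewrite subrr; exact: rpred0.
have [e0|/eqP e0] := pselect (P g = 0).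
  exists P; split=> // [x|x /perp_cons[_ /GP]//].
  apply/perp_cons; split=> //.
  by rewrite sP e0 inner0r.
have := e0; set e := P g => /eqP/nrm2_gt0 n0.
(* Only the component [e] of the new vector [g] in [perp G] has to be removed. *)
pose c : R := (nrm2 e)^-1.
have ce : c%:C * (nrm2 e)%:C = 1 by rewrite -rmorphM mulVf// gt_eqF.
pose Q := P - scal H c * rank_one e.
have QE x : Q x = P x - c%:C *: (inner x e *: e) by [].
have Pe : P e = e by exact: PP.
have ge : inner e g = (nrm2 e)%:C by rewrite -inner_nrm2 -[in LHS]Pe sP.
have Pxe x : inner (P x) e = inner x e by rewrite sP Pe.
have Pxg x : inner (P x) g = inner x e by rewrite sP.
exists Q; split=> [x y|x|x|x /perp_cons[xg xG]|].
- rewrite !QE innerBl innerBr sP !innerZl !innerZr conjc_real -innerC.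
  by rewrite (mulrC (inner x e)).
- rewrite !QE bopB !bopZ PP Pe innerBl !innerZl Pxe inner_nrm2.
  by rewrite mulrCA ce mulr1 subrr scale0r scaler0 subr0.
- apply/perp_cons; split.
    by rewrite QE innerBl !innerZl ge mulrCA ce mulr1 Pxg subrr.
  rewrite QE; apply: subspaceB (perp_subspace _) _ _ => //.
  do 2 apply: subspaceZ (perp_subspace _) _.
  by have := PG g.
- by rewrite QE -Pxg GP// xg scale0r scaler0 subr0.
- rewrite /Q opprB addrCA addrC; apply: rpredD => //.
  exact/compact_opM/compact_rank_one.
Qed.

Lemma projection_nrm2 P x : selfadjoint P -> (forall x, P (P x) = P x) ->
  nrm2 (P x) <= nrm2 x /\ nrm2 (x - P x) <= nrm2 x.
Proof.
move=> sP PP; have PxPx : rip x (P x) = nrm2 (P x).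
  by rewrite /nrm2 selfadjoint_rip// PP.
have := nrm2_ge0 (x - P x); have := nrm2_ge0 (P x).
have -> : nrm2 (x - P x) = nrm2 x - nrm2 (P x).
  by rewrite {1}/nrm2 !ripE -!/(nrm2 _) (ripC (P x) x) PxPx; lra.
by lra.
Qed.

(** Compactness expressed through the spaces of finite codimension. *)
Definition small_on_perps S : Prop := forall d : R, 0 < d ->
  exists G, forall x, perp G x -> nrm2 (S x) <= d * nrm2 x.

(** With [P] the projection onto [perp G], [S] is uniformly close on the unit
    ball to the compact operator [S (1 - P)]. *)
Lemma small_on_perps_compact S : small_on_perps S -> S \in compact_op H.
Proof.
move=> Ss; apply: nets_compact_op => d d0.
have [|G GS] := Ss (d / 4); first by rewrite divr_gt0.
have [P [sP PP PG _ cP]] := perp_projection G.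
have /compact_op_nets nP : S * (1 - P) \in compact_op H by exact: compact_opM.
have [|L LP] := nP (d / 4); first by rewrite divr_gt0.
exists L => x x1; have [g gL gx] := LP _ x1; exists g => //.
have -> : g - S x = (g - (S * (1 - P)) x) - S (P x).
  by rewrite bop_mulE bop_addE bop_oppE bop_oneE bopB opprB addrA addrAC addrK.
have := nrm2B_le (g - (S * (1 - P)) x) (S (P x)).
have := GS _ (PG x); have [] := projection_nrm2 x sP PP.
have := nrm2_ge0 (P x); nra.
Qed.

(** The values [inner x g], for [g] in [G], are coordinates on a subspace that
    meets [perp G] trivially. By induction on [G]: either [g] is orthogonal to
    [E], or one vector of [E] accounts for the coordinate along [g]. *)
Lemma finite_span G E : subspace E -> (forall x, E x -> perp G x -> x = 0) ->
  exists s : seq H, [/\ forall g, g \in s -> E g &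
    forall x, E x -> exists a : 'I_(size s) -> R[i], x = \sum_i a i *: s`_i].
Proof.
elim: G E => [|g G IH] E sE EG.
  exists [::]; split=> // x Ex; exists (fun=> 0); rewrite big_ord0; exact: EG.
have [s [sE' s_span]] : exists s : seq H,
    [/\ forall h, h \in s -> (E `&` perp [:: g]) h &
    forall x, (E `&` perp [:: g]) x ->
      exists a : 'I_(size s) -> R[i], x = \sum_i a i *: s`_i].
  apply: IH => [|x [Ex /perp_cons[xg _]] xG].
    exact: subspaceI sE (perp_subspace _).
  by apply: EG => //; apply/perp_cons.
have [[v [Ev vg]]|nv] := pselect (exists v, E v /\ inner v g <> 0); last first.
  exists s; split=> [h /sE'[]//|x Ex]; apply: s_span; split=> //.
  apply/perp_cons; split=> //; apply: contrapT => xg.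
  by apply: nv; exists x.
exists (v :: s); split=> [h|x Ex].
  by rewrite inE => /orP[/eqP ->//|/sE'[]].
have /s_span[a xa] : (E `&` perp [:: g]) (x - (inner x g / inner v g) *: v).
  split; first by apply: subspaceB => //; apply: subspaceZ.
  apply/perp_cons; split=> //.
  by rewrite innerBl innerZl mulfVK ?subrr//; exact/eqP.
exists (fun i => oapp a (inner x g / inner v g) (unlift ord0 i)).
rewrite big_ord_recl/= unlift_none/=.
rewrite -[LHS](subrK ((inner x g / inner v g) *: v)) addrC xa.
by congr (_ + _); apply: eq_bigr => i _; rewrite liftK.
Qed.

Lemma inner_suml n (a : 'I_n -> R[i]) (f : 'I_n -> H) y :
  inner (\sum_i a i *: f i) y = \sum_i a i * inner (f i) y.
Proof.
elim/big_ind2: _ => [|x u z v <- <-|i _]; first exact: inner0l.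
- exact: innerDl.
- exact: innerZl.
Qed.

Lemma finite_span_orth s E x :
  (forall y, E y -> exists a : 'I_(size s) -> R[i], y = \sum_i a i *: s`_i) ->
  perp s x -> orth E x.
Proof.
move=> sE sx y /sE[a ->]; rewrite innerC inner_suml big1 ?conjc0// => i _.
by rewrite innerC sx ?conjc0 ?mulr0//=; exact: mem_nth.
Qed.

Lemma perp_nontrivial G : ~ finite_dimensional H -> exists2 x, perp G x & x <> 0.
Proof.
move=> infH; apply: contrapT => nG; apply: infH.
have [|s [_ sP]] := @finite_span G setT (@subspaceT R H).
  by move=> x _ Gx; apply: contrapT => x0; apply: nG; exists x.
by exists s => v; exact: sP.
Qed.

End Projections.

(** * Essential spectrum *)

Section EssentialSpectrum.
Variables (R : realType) (H : hilbertType R).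
Variable infH : ~ finite_dimensional H.
Implicit Types (x y z g e : H) (S T K B : bop H) (G : seq H).

Lemma perp_unit G : exists2 x, perp G x & nrm2 x = 1.
Proof.
have [x Gx /normalize[a _ ax]] := perp_nontrivial G infH.
by exists (a%:C *: x) => //; exact: (subspaceZ _ (perp_subspace G)).
Qed.

(** Cauchy-Schwarz applied to [x] and [B x]: where the form of [B] is small and
    nonnegative, so is [B x]. Adding [map B G] keeps [B x] in [perp G]. *)
Lemma image_le_qform G B x (C : R) : selfadjoint B -> 0 <= C ->
  (forall z, perp G z -> 0 <= qform B z <= C * nrm2 z) ->
  perp (G ++ map B G) x -> nrm2 (B x) <= C * qform B x.
Proof.
move=> sB C0 BC /perp_cat[Gx BGx].
have GBx := selfadjoint_perp sB BGx.
have B0 z : perp G z -> 0 <= qform B z by move=> /BC/andP[].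
have := cauchy_schwarz_on (perp_subspace G) sB B0 Gx GBx.
have /andP[_] := BC _ GBx; rewrite -/(nrm2 (B x)).
have := B0 _ Gx; have := nrm2_ge0 (B x).
move: (nrm2 (B x)) (qform B x) (qform B (B x)) => n q q' n0 q0 q'C nq.
have [->|n1] := eqVneq n 0; first exact: mulr_ge0.
have {}n0 : 0 < n by rewrite lt_neqAle eq_sym n1.
by rewrite -(ler_pM2r n0); nra.
Qed.

Lemma small_factor (d C : R) : 0 < d -> 0 <= C ->
  exists e : R, [/\ 0 < e, e <= 1 & e * C <= d].
Proof.
move=> d0 C0; have dC : 0 < d + C by lra.
exists (d / (d + C)); split; first by rewrite divr_gt0.
- by rewrite ler_pdivrMr//; lra.
- by rewrite mulrAC ler_pdivrMr// ler_pM2l//; lra.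
Qed.

(** [S + e] has a form between [0] and [2 e] on some [perp G], to which
    Cauchy-Schwarz applies. *)
Lemma qform_small_on_perps S : selfadjoint S ->
  (forall d : R, 0 < d -> exists G, forall x, perp G x -> `|qform S x| <= d * nrm2 x) ->
  small_on_perps S.
Proof.
move=> sS Ss d d0; have [|e [e0 e1 ed]] := @small_factor d 10 d0; first by lra.
have [G GS] := Ss _ e0; pose B := S + scal H e.
have sB : selfadjoint B := selfadjointD sS (selfadjoint_scal e).
have BE x : qform B x = qform S x + e * nrm2 x by rewrite qformD qform_scal.
exists (G ++ map B G) => x Gx.
have GB z : perp G z -> 0 <= qform B z <= (2 * e) * nrm2 z.
  by move=> /GS; rewrite BE ler_norml => /andP[? ?]; apply/andP; split; lra.
have Bx : nrm2 (B x) <= 2 * e * qform B x by apply: (image_le_qform sB _ GB Gx); lra.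
have /andP[_ Bx'] : 0 <= qform B x <= (2 * e) * nrm2 x.
  by apply: GB; have /perp_cat[] := Gx.
have -> : S x = B x - e%:C *: x by rewrite addrK.
have := nrm2B_le (B x) (e%:C *: x); rewrite nrm2Z.
have n0 := nrm2_ge0 x.
have : 2 * e * qform B x <= 2 * e * (2 * e * nrm2 x) by rewrite ler_pM2l//; lra.
have : e * (10 * e) * nrm2 x <= d * nrm2 x by rewrite ler_wpM2r//; nra.
lra.
Qed.

(** The largest point of the essential spectrum of a self-adjoint operator, as
    an infimum over finite codimension of upper bounds of its form. *)
Definition ess_upper S : R :=
  inf [set c : R | exists G, forall x, perp G x -> qform S x <= c * nrm2 x].

Lemma ess_upper_has_inf S :
  has_inf [set c : R | exists G, forall x, perp G x -> qform S x <= c * nrm2 x].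
Proof.
split; first by have [C _ SC] := qform_bound S; exists C, [::].
have [C _ SC] := qform_bound (- S); exists (- C) => c [G Gc].
have [x Gx x1] := perp_unit G; have := Gc _ Gx; have := SC x.
by rewrite qformN x1; lra.
Qed.

Lemma ess_upper_le S (d : R) : 0 < d ->
  exists G, forall x, perp G x -> qform S x <= (ess_upper S + d) * nrm2 x.
Proof.
move=> d0; have [c [G Gc] cd] := inf_adherent d0 (ess_upper_has_inf S).
exists G => x Gx; apply: le_trans (Gc _ Gx) _.
by rewrite ler_wpM2r ?nrm2_ge0// ltW.
Qed.

Lemma ess_upper_gt S (c : R) G : c < ess_upper S ->
  exists2 x, perp G x & c * nrm2 x < qform S x.
Proof.
move=> cS; apply: contrapT => nx; have : ess_upper S <= c.
  apply: (ge_inf (ess_upper_has_inf S).2); exists G => x Gx.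
  by rewrite leNgt; apply/negP => xc; apply: nx; exists x.
by lra.
Qed.

(** Weyl's singular sequences, without sequences: unit vectors that are almost
    annihilated exist in every subspace [perp G]. *)
Definition approx_kernel S : Prop := forall (d : R) G, 0 < d ->
  exists x, [/\ perp G x, nrm2 x = 1 & nrm2 (S x) <= d].

(** With [q = ess_upper S], the form of [B = q + e - S] is nonnegative on some
    [perp G0], and every space of finite codimension contains vectors where it is
    at most [2 e nrm2]; there [B x] is small by Cauchy-Schwarz. *)
Lemma ess_upper_approx_kernel S :
  selfadjoint S -> approx_kernel (S - scal H (ess_upper S)).
Proof.
move=> sS d G d0; set q := ess_upper S.
(* The bound [C] of the form of [B] has to be uniform in [e]. *)
pose B0 := scal H (q + 1) - S; have [C C0 B0C] := qform_bound B0.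
have [|e [e0 e1 ed]] := @small_factor d (2 + 4 * C) d0; first by lra.
have [G0 G0S] := ess_upper_le S e0; pose B := scal H (q + e) - S.
have sB : selfadjoint B := selfadjointB (selfadjoint_scal _) sS.
have BE x : qform B x = (q + e) * nrm2 x - qform S x by rewrite qformB qform_scal.
have [|x] := @ess_upper_gt S (q - e) ((G0 ++ map B G0) ++ G); first by lra.
move=> /perp_cat[G0x Gx] xS.
have /normalize[a a0 ax1] : x <> 0.
  by move=> x0; move: xS; rewrite x0 qform0 nrm20; lra.
exists (a%:C *: x); split=> //; first exact: (subspaceZ _ (perp_subspace G)).
have Bx : nrm2 (B x) <= C * qform B x.
  apply: (image_le_qform sB (ltW C0) _ G0x) => z /G0S; rewrite -/q => zS.
  have := B0C z; rewrite qformB qform_scal; have := nrm2_ge0 z => z0 zC.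
  by rewrite BE; apply/andP; split; nra.
rewrite bopZ nrm2Z.
have -> : (S - scal H q) x = e%:C *: x - B x.
  rewrite !bop_addE !bop_oppE !scalE rmorphD scalerDl opprB.
  by rewrite addrCA opprD [e%:C *: x + _]addrCA subrr addr0.
have := nrm2B_le (e%:C *: x) (B x); move: ax1; rewrite !nrm2Z.
move: Bx xS; rewrite BE -/q.
have := nrm2_ge0 x; have : 0 < a ^+ 2 by rewrite exprn_even_gt0.
move: (nrm2 (_ - _)) (nrm2 (B x)) (nrm2 x) (qform S x) => m b n s.
move: (a ^+ 2) => a2 a20 n0 bC ns an mm.
have : m <= e * (2 + 4 * C) * n.
  have : C * ((q + e) * n - s) <= C * (2 * e * n) by rewrite ler_pM2l//; lra.
  have : e ^+ 2 * n <= e * n by rewrite ler_wpM2r//; nra.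
  nra.
move=> mn; have : a2 * m <= e * (2 + 4 * C) * (a2 * n) by nra.
by rewrite an; lra.
Qed.

(** If [Y S = 1 - K] with [K] compact, then an almost null unit vector [x] of
    [S] is close to [K x], hence to a finite set to which it is orthogonal. *)
Lemma approx_kernel_not_unit S : approx_kernel S ->
  ~ exists y : calkin H, y * calkin_pi S = 1 /\ calkin_pi S * y = 1.
Proof.
move=> kS [y [yS _]]; pose Y := calkin_repr y.
have cK : 1 - Y * S \in compact_op H.
  apply/calkin_piP; rewrite -calkin_mul_pi [calkin_pi Y]calkin_reprK.
  exact/esym.
clear yS; have [|G GK] := compact_op_nets cK (e := 1/16); first by lra.
have [C C0 YC] := nrm2_bound Y.
have [|x [Gx x1 Sx]] := kS (1 / (16 * C)) G; first by rewrite divr_gt0//; lra.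
have [|g gG gx] := GK x; first by rewrite x1.
have Yx : nrm2 (Y (S x)) <= 1/16.
  have : C * nrm2 (S x) <= C * (1 / (16 * C)) by rewrite ler_pM2l.
  have -> : C * (1 / (16 * C)) = 1 / 16 by field; lra.
  by have := YC (S x); lra.
have := nrm2B_le (g - (1 - Y * S) x) (Y (S x)).
have -> : g - (1 - Y * S) x - Y (S x) = g - x.
  by rewrite bop_addE bop_oppE bop_mulE bop_oneE opprB addrA addrAC addrK.
have -> : nrm2 (g - x) = nrm2 g + nrm2 x.
  rewrite {1}/nrm2 !ripE (ripC g x) (inner0_rip (Gx _ gG)) opprK.
  by rewrite oppr0 addr0 add0r.
by have := nrm2_ge0 g; lra.
Qed.

Lemma ess_spectrumE T l : ess_spectrum T l <->
  ~ exists y : calkin H, y * calkin_pi (T - bop_scalar H l) = 1 /\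
    calkin_pi (T - bop_scalar H l) * y = 1.
Proof. by rewrite raddfB. Qed.

Lemma approx_kernel_ess_spectrum T (a : R) :
  approx_kernel (T - scal H a) -> ess_spectrum T a%:C.
Proof. by move=> /approx_kernel_not_unit k; exact/ess_spectrumE. Qed.

(** The Calkin image of [T] is the scalar [a], and scalars are invertible there
    exactly when they are nonzero: the zero operator has an approximate kernel
    because [H] is infinite dimensional. *)
Lemma ess_spectrum_compact T (a : R) :
  T - scal H a \in compact_op H -> ess_spectrum T = [set a%:C].
Proof.
move=> cT; have piT l : calkin_pi (T - bop_scalar H l) =
    calkin_pi (bop_scalar H (a%:C - l)).
  by apply/calkin_piP; rewrite raddfB opprB addrA subrK.
apply/seteqP; split=> l.
  move=> /ess_spectrumE nl; apply: contrapT => /= /eqP la; apply: nl.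
  have al : a%:C - l != 0 by rewrite subr_eq0 eq_sym.
  exists (calkin_pi (bop_scalar H (a%:C - l)^-1)).
  by rewrite piT -!rmorphM mulVf// mulfV// !rmorph1.
move=> /= ->; apply/ess_spectrumE; rewrite piT subrr.
have -> : bop_scalar H 0 = 0 by rewrite raddf0.
apply: approx_kernel_not_unit => d G d0.
have [x Gx x1] := perp_unit G; exists x; split=> //.
by rewrite (_ : (0 : bop H) x = 0)// nrm20 ltW.
Qed.

(** The upper essential bounds of [T] and of [- T] yield two points of the
    essential spectrum, its extreme points. If they coincide with [a], the form
    of [T - a] is small in finite codimension, hence so is [T - a]. *)
Lemma ess_spectrum1_compact T alpha : selfadjoint T ->
  ess_spectrum T = [set alpha] ->
  exists2 a : R, alpha = a%:C & T - scal H a \in compact_op H.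
Proof.
move=> sT Ta; have sNT := selfadjointN sT.
set a := ess_upper T; set b := ess_upper (- T).
have aE : a%:C = alpha.
  have : ess_spectrum T a%:C.
    by apply: approx_kernel_ess_spectrum; exact: ess_upper_approx_kernel.
  by rewrite Ta.
have bE : (- b)%:C = alpha.
  have : ess_spectrum T (- b)%:C.
    apply: approx_kernel_ess_spectrum => d G d0.
    have [x [Gx x1 xd]] := ess_upper_approx_kernel sNT G d0.
    exists x; split=> //; apply: le_trans xd; rewrite -nrm2N le_eqVlt; apply/orP; left.
    apply/eqP; congr nrm2; rewrite !bop_addE !bop_oppE !scalE -/b.
    by rewrite rmorphN scaleNr opprK opprD.
  by rewrite Ta.
have ab : a = - b by apply: complexI; rewrite aE bE.
exists a => //; apply: small_on_perps_compact.
apply: qform_small_on_perps => [|d d0].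
  exact: selfadjointB sT (selfadjoint_scal _).
have [G1 G1a] := ess_upper_le T d0; have [G2 G2b] := ess_upper_le (- T) d0.
exists (G1 ++ G2) => x /perp_cat[/G1a xa /G2b].
move: xa; rewrite -/a -/b ab qformN qformB qform_scal ler_norml => xa xb.
by apply/andP; split; lra.
Qed.

End EssentialSpectrum.

(** * Maximizers of compact forms, invertibility and eigenvalues *)

Section Maximizers.
Variables (R : realType) (H : hilbertType R).
Implicit Types (x y z g e : H) (S T K B : bop H) (G : seq H) (M : set H).

Lemma qform_parallelogram_le M B x y : subspace M -> selfadjoint B ->
  (forall z, M z -> 0 <= qform B z) -> M x -> M y ->
  qform B (x - y) <= 2 * qform B x + 2 * qform B y /\
  qform B (x + y) <= 2 * qform B x + 2 * qform B y.
Proof.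
move=> sM sB B0 Mx My; have := qformBD x y sB.
by have := B0 _ (subspaceB sM Mx My); have := B0 _ (subspaceD sM Mx My); lra.
Qed.

(** Along an ultrafilter of almost maximizers the images under [K] converge;
    since [qform (b - K)] is nonnegative on [M] and small at almost maximizers,
    [b |x - y|^2 = qform (b - K) (x - y) + qform K (x - y)] shows that the almost
    maximizers themselves form a Cauchy filter. *)
Lemma compact_maximizer K M x1 : selfadjoint K -> K \in compact_op H ->
  subspace M -> closed M -> M x1 -> 0 < qform K x1 ->
  exists x0, [/\ M x0, x0 <> 0 &
    forall x, M x -> qform K x * nrm2 x0 <= qform K x0 * nrm2 x].
Proof.
move=> sK cK sM cM Mx1 Kx1.
pose V := [set qform K x | x in [set x | M x /\ nrm2 x = 1]].
have V1 x : M x -> x <> 0 -> exists2 v, V v & qform K x = v * nrm2 x.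
  move=> Mx /normalize[a a0 ax]; exists (qform K (a%:C *: x)).
    by exists (a%:C *: x) => //; split=> //; exact: subspaceZ.
  move: ax; rewrite qformZ nrm2Z => ax.
  by rewrite mulrAC ax mul1r.
have supV : has_sup V.
  have [C _ KC] := qform_bound K; split.
    have [|v Vv _] := V1 _ Mx1; first by move=> x0; rewrite x0 qform0 ltxx in Kx1.
    by exists v.
  by exists C => _ [x [_ x1'] <-]; have := KC x; rewrite x1' mulr1.
pose b := sup V.
have Kb x : M x -> qform K x <= b * nrm2 x.
  move=> Mx; have [->|x0] := pselect (x = 0); first by rewrite qform0 nrm20 mulr0.
  have [v Vv ->] := V1 _ Mx x0; rewrite ler_wpM2r ?nrm2_ge0//.
  exact: (ub_le_sup supV.2).
have b0 : 0 < b by have := Kb _ Mx1; have := nrm2_ge0 x1; nra.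
pose B := scal H b - K.
have sB : selfadjoint B := selfadjointB (selfadjoint_scal _) sK.
have BE x : qform B x = b * nrm2 x - qform K x by rewrite qformB qform_scal.
have B0 x : M x -> 0 <= qform B x by move=> /Kb; rewrite BE subr_ge0.
pose A d := [set x | [/\ M x, nrm2 x = 1 & qform B x < d]].
have [|d d' dd' x [Mx x1' xd]|U UU UA] := @ultrafilter_of _ H A.
- move=> d d0; have [_ [x [Mx x1'] <-] xd] := sup_adherent d0 supV.
  by exists x; split=> //; rewrite BE x1' -/b; move: xd; rewrite -/b; lra.
- by split=> //; exact: lt_le_trans xd dd'.
have [|l Ul] := @complete_nrm2 _ _ U _.
  move=> e e0.
  have [|//|h [h0 h1 hb]] := @small_factor R (b * e) 16; first exact: mulr_gt0.
  have hh : 0 < h ^+ 2 by rewrite exprn_gt0.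
  have [G GK] := compact_op_nets cK hh.
  have [|g _ Ug] := @ultra_seq _ U _ G (fun g => [set x | nrm2 (g - K x) < h ^+ 2]) UU.
    apply: filterS (UA 1 ltr01) => x [_ x1' _].
    by have [|g gG gx] := GK x; [rewrite x1'|exists g].
  (* On this member of [U] the vectors are almost maximal and have almost the
     same image. *)
  have UW : U ([set x | nrm2 (g - K x) < h ^+ 2] `&` A (h ^+ 2)).
    exact: filterI (UA _ hh).
  have [x [gx [Mx x1' Bx]]] := filter_ex UW.
  exists x; apply: filterS UW => y [gy [My y1 By]] /=.
  have [Bxy _] := qform_parallelogram_le sM sB B0 Mx My.
  have Kxy : nrm2 (K (x - y)) <= 4 * h ^+ 2.
    have := nrm2B_le (g - K y) (g - K x).
    have -> : g - K y - (g - K x) = K (x - y).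
      by rewrite bopB opprB addrCA [g - _ - _]addrAC subrr add0r.
    by move: gx gy => /=; lra.
  have := rip_cauchy_schwarz (K (x - y)) (x - y); rewrite -/(qform K _).
  have := nrm2B_le x y; have := BE (x - y); move: Bxy Kxy.
  have := nrm2_ge0 (x - y); rewrite x1' y1.
  move: (qform B (x - y)) (qform K (x - y)) (nrm2 (K _)) (nrm2 (x - y)).
  move=> qb qk k n n0 qbxy kh qbE n4 qkn.
  have qk2 : qk ^+ 2 <= (4 * h) ^+ 2 by nra.
  have qk4 : qk <= 4 * h.
    rewrite leNgt; apply/negP => qk4.
    have : 0 < (qk - 4 * h) * (qk + 4 * h) by apply: mulr_gt0; lra.
    by lra.
  by rewrite -(ltr_pM2l b0); nra.
have Ml : M l.
  apply: ((closed_nrm2 M).1 cM) => e e0.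
  have [x [lx [Mx _ _]]] := filter_ex (filterI (Ul _ e0) (UA 1 ltr01)).
  by exists x.
have Bl : qform B l = 0.
  apply/eqP; rewrite eq_le B0// andbT; apply/ler_addgt0Pr => e e0; rewrite add0r.
  have [C C0 BC] := qform_bound B.
  have [||d [d0 _ de]] := @small_factor R e (2 + 2 * C) => //; first by lra.
  have [x [lx [Mx _ Bx]]] := filter_ex (filterI (Ul _ d0) (UA _ d0)).
  have Mlx := subspaceB sM Ml Mx.
  have [_] := qform_parallelogram_le sM sB B0 Mlx Mx; rewrite subrK.
  by have := BC (l - x); have := nrm2_ge0 (l - x); move: lx => /=; nra.
exists l; split=> //.
  have d0 : 0 < (1/4 : R) by lra.
  have [x [lx [Mx x1' Bx]]] := filter_ex (filterI (Ul _ d0) (UA _ ltr01)).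
  move=> l0; move: lx; rewrite /= l0 sub0r nrm2N x1'; lra.
move=> x /Kb; move: Bl; rewrite BE => /eqP; rewrite subr_eq0 => /eqP <- Kx.
by rewrite mulrAC; apply: ler_wpM2r => //; exact: nrm2_ge0.
Qed.

(** [S] being self-adjoint, a least-squares solution of [S x = y] is an exact
    one: the residual is orthogonal to the range of [S], so it is killed by [S].
    The parallelogram law makes almost minimizers of the residual Cauchy. *)
Lemma bounded_below_surjective S (c : R) : selfadjoint S -> 0 < c ->
  (forall x, c * nrm2 x <= nrm2 (S x)) -> forall y, exists x, S x = y.
Proof.
move=> sS c0 Sc y; pose V := range (fun x => nrm2 (S x - y)).
have infV : has_inf V.
  by split; [exists (nrm2 (S 0 - y)), 0|exists 0 => _ [x _ <-]; exact: nrm2_ge0].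
pose m := inf V.
have Vm x : m <= nrm2 (S x - y) by apply: (ge_inf infV.2); exists x.
pose A d := [set x | nrm2 (S x - y) < m + d].
have [|d d' dd' x|U UU UA] := @ultrafilter_of _ H A.
- by move=> d d0; have [_ [x _ <-] xd] := inf_adherent d0 infV; exists x.
- by rewrite /A/=; lra.
have [|l Ul] := @complete_nrm2 _ _ U _.
  move=> e e0; have d0 : 0 < c * e / 4 by rewrite divr_gt0// mulr_gt0.
  have [x Ax] := filter_ex (UA _ d0); exists x.
  apply: filterS (UA _ d0) => z Az; move: Ax Az; rewrite /A/= => Ax Az.
  have := Vm ((2^-1)%:C *: (x + z)); have := Sc (x - z).
  have -> : S (x - z) = (S x - y) - (S z - y) by rewrite bopB opprB addrA subrK.
  have -> : S ((2^-1)%:C *: (x + z)) - y = (2^-1)%:C *: ((S x - y) + (S z - y)).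
    rewrite bopZ bopD [in RHS]addrACA [in RHS]scalerDr; congr (_ + _).
    have -> : - y - y = (1 + 1 : R[i]) *: - y by rewrite scalerDl scale1r.
    rewrite scalerA -[1 + 1](rmorphD (real_complex R) 1 1) -rmorphM.
    by rewrite mulVf ?scale1r// pnatr_eq0.
  rewrite nrm2Z -(ltr_pM2l c0); move: Ax Az.
  rewrite (_ : nrm2 (S x - y + (S z - y)) = 2 * nrm2 (S x - y) +
      2 * nrm2 (S z - y) - nrm2 (S x - y - (S z - y))).
    by move=> *; lra.
  by rewrite /nrm2 !(ripDl, ripDr, ripNl, ripNr) (ripC (S z)); lra.
exists l; suff Sly : S (S l - y) = 0.
  apply/eqP; rewrite -subr_eq0; apply/eqP/nrm2_eq0; apply/eqP.
  have := Sc (S l - y); rewrite Sly nrm20 pmulr_rle0// => h.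
  by rewrite eq_le h nrm2_ge0.
apply: nrm2_eq0; rewrite /nrm2 selfadjoint_rip//; move: (S (S l - y)) => z.
apply/eqP; rewrite -sqrf_eq0 eq_le sqr_ge0 andbT.
apply/ler_addgt0Pr => e e0; rewrite add0r.
have [C C0 SC] := nrm2_bound S; have n0 := nrm2_ge0 (S z).
have [||d [d0 _ de]] := @small_factor R e ((2 + 2 * C) * nrm2 (S z)) => //; first by nra.
have [x [lx Ax]] := filter_ex (filterI (Ul _ d0) (UA _ d0)).
(* Almost minimality of the residual at [x] makes it almost orthogonal to [S z]. *)
have r1 : rip (S x - y) (S z) ^+ 2 <= d * nrm2 (S z).
  apply: discriminant => // t; have := Vm (x + t%:C *: z); move: Ax.
  rewrite /A /= bopD bopZ addrAC => Ax.
  rewrite {1}/nrm2 !(ripDl (S x - y), ripDr _ (S x - y)).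
  rewrite -/(nrm2 (S x - y)) !ripZl !ripZr (ripC (S z)).
  by rewrite -/(nrm2 (S z)); lra.
have r2 : rip (S (l - x)) (S z) ^+ 2 <= (C * d) * nrm2 (S z).
  apply: le_trans (rip_cauchy_schwarz _ _) _; rewrite ler_wpM2r//.
  by apply: le_trans (SC _) _; rewrite ler_wpM2l// ltW.
have -> : S l - y = (S x - y) + S (l - x) by rewrite bopB [RHS]addrC addrA subrK.
rewrite ripDl; move: (rip _ _) (rip _ _) r1 r2 => u v r1 r2.
have := sqr_ge0 (u - v).
by lra.
Qed.

Lemma bounded_below_unit S (c : R) : selfadjoint S -> 0 < c ->
  (forall x, c * nrm2 x <= nrm2 (S x)) -> exists Y : bop H, Y * S = 1 /\ S * Y = 1.
Proof.
move=> sS c0 Sc.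
have [Y SY] := choice (bounded_below_surjective sS c0 Sc).
have injS x z : S x = S z -> x = z.
  move=> Sxz; apply/eqP; rewrite -subr_eq0; apply/eqP/nrm2_eq0/eqP.
  have := Sc (x - z); rewrite bopB Sxz subrr nrm20 pmulr_rle0// => h.
  by rewrite eq_le h nrm2_ge0.
have bY : Y \in @bounded_linear _ H.
  apply: (@bounded_linear_nrm2 _ _ Y c^-1) => [a x z|x].
    by apply: injS; rewrite bopD bopZ !SY.
  by rewrite ler_pdivlMl// -[X in _ <= nrm2 X]SY.
exists (Bop bY); split; apply: bopP => x; last exact: SY.
by apply: injS; exact: SY.
Qed.

Lemma eigenvalue_op_spectrum T (a : R) x : x <> 0 -> T x = a%:C *: x ->
  op_spectrum T a%:C.
Proof.
move=> x0 Tx [Y [YT _]]; apply: x0.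
have := congr1 (fun S : bop H => S x) YT.
by rewrite bop_mulE bop_addE bop_oppE bop_scaleE !bop_oneE Tx subrr bop0 => <-.
Qed.

(** Away from [a], the spectrum of a self-adjoint compact perturbation of [a]
    consists of eigenvalues: [(a - l)^2 - (T - l)^2] is compact, and its form
    attains the value [(a - l)^2] unless [T - l] is bounded below. *)
Lemma op_spectrum_eigenvalue T (a l : R) : selfadjoint T ->
  T - scal H a \in compact_op H -> l != a -> op_spectrum T l%:C ->
  exists2 x, x <> 0 & T x = l%:C *: x.
Proof.
move=> sT cT la Tl; apply: contrapT => nx; apply: Tl.
pose S := T - scal H l; have sS : selfadjoint S := selfadjointB sT (selfadjoint_scal _).
suff [c c0 Sc] : exists2 c : R, 0 < c & forall x, c * nrm2 x <= nrm2 (S x).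
  exact: bounded_below_unit sS c0 Sc.
pose b := (a - l) ^+ 2; pose K := scal H b - S * S.
have b0 : 0 < b by rewrite exprn_even_gt0//= subr_eq0 eq_sym.
have KE x : qform K x = b * nrm2 x - nrm2 (S x).
  by rewrite qformB qform_scal qform_sqr.
have sK : selfadjoint K.
  by apply: selfadjointB (selfadjoint_scal _) (selfadjoint_sqr sS).
have cK : K \in compact_op H.
  have -> : K = (T - scal H a) * (scal H (a - l) + S) * -1.
    have -> : T - scal H a = S - scal H (a - l).
      by rewrite /S /scal rmorphB raddfB opprB addrA subrK.
    rewrite /K mulrN1; have -> : scal H b = scal H (a - l) * scal H (a - l).
      by rewrite /scal -!rmorphM.
    have : S * scal H (a - l) = scal H (a - l) * S.
      by apply: bopP => x; rewrite !bop_mulE !scalE bopZ.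
    move: (scal H (a - l)) (S) => c S' comm; rewrite mulrBl !mulrDr comm opprB.
    by rewrite opprD addrA addrK.
  exact/compact_opMr/compact_opMr.
have [[x1 Kx1]|nK] := pselect (exists x, 0 < qform K x); last first.
  exists b => // x; have : qform K x <= 0.
    by rewrite leNgt; apply/negP => Kx; apply: nK; exists x.
  by rewrite KE; lra.
have [x0 [_ x00 Kmax]] :=
  compact_maximizer sK cK (@subspaceT R H) closedT I Kx1.
have n0 := nrm2_gt0 x00; pose r := qform K x0 / nrm2 x0.
have rE : r * nrm2 x0 = qform K x0 by rewrite divfK// gt_eqF.
exists (b - r) => [|x].
  rewrite ltNge; apply/negP => br; apply: nx; exists x0 => //.
  apply/eqP; rewrite -subr_eq0; apply/eqP/nrm2_eq0/eqP.
  rewrite -[T x0 - _]/(S x0) eq_le nrm2_ge0 andbT.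
  by have := KE x0; rewrite -rE; nra.
have := Kmax x I; rewrite -rE mulrAC ler_pM2r// KE; lra.
Qed.

End Maximizers.

(** * Norm attainment excludes orthogonal sequences with increasing quotients *)

Section AttainingToSpectrum.
Variables (R : realType) (H : hilbertType R).
Implicit Types (x y z g e : H) (S T K A B : bop H) (G : seq H) (M : set H).

Definition nonzero_subspace M : Prop :=
  [/\ subspace M, closed M & exists2 x, M x & x <> 0].

(** Norm attainment in homogeneous form: the quotient [nrm2 (T x) / nrm2 x] has a
    maximum on each nonzero closed subspace. *)
Definition has_maximizers T : Prop := forall M, nonzero_subspace M ->
  exists x0, [/\ M x0, x0 <> 0 &
    forall x, M x -> nrm2 (T x) * nrm2 x0 <= nrm2 (T x0) * nrm2 x].

(** A norm-attaining vector of the unit ball is a maximizer unless it is [0], and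
    then [T] vanishes on the subspace; conversely a maximizer is normalized. *)
Lemma absolutely_norm_attainingP T :
  absolutely_norm_attaining T <-> has_maximizers T.
Proof.
split=> [ANT M [sM cM [y My y0]]|maxT M sM cM M0].
  have [|x0 [Mx0 /norm_le1_nrm2 x01] Tx0] := ANT M sM cM.
    by move=> M0; move: My; rewrite M0.
  set V := [set rnorm (T x) | x in _] in Tx0.
  have supV : has_sup V.
    split; first by exists (rnorm (T x0)), x0 => //; split=> //; exact/norm_le1_nrm2.
    have [C C0 TC] := nrm2_bound T; exists (Num.sqrt C) => _ [x [_ /norm_le1_nrm2 x1] <-].
    rewrite rnorm_sqrt ler_wsqrtr// (le_trans (TC x))//.
    by rewrite -[leRHS]mulr1 ler_wpM2l// ltW.
  have Tmax x : M x -> nrm2 (T x) <= nrm2 (T x0) * nrm2 x.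
    move=> Mx; have [->|xn0] := pselect (x = 0); first by rewrite bop0 nrm20 mulr0.
    have [a a0 ax1] := normalize xn0.
    have : rnorm (T (a%:C *: x)) <= rnorm (T x0).
      rewrite Tx0; apply: (ub_le_sup supV.2); exists (a%:C *: x) => //.
      by split; [exact: subspaceZ|apply/norm_le1_nrm2; rewrite ax1].
    rewrite !rnorm_sqrt ler_sqrt ?nrm2_ge0// bopZ !nrm2Z => h.
    have a2 : 0 < a ^+ 2 by rewrite exprn_even_gt0.
    by rewrite nrm2Z in ax1; rewrite -(ler_pM2l a2) mulrCA ax1 mulr1.
  have [x00|x00] := pselect (x0 = 0).
    exists y; split=> // x Mx; have := Tmax _ Mx.
    by rewrite x00 bop0 nrm20 mul0r; have := nrm2_ge0 y; have := nrm2_ge0 (T y);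
      have := nrm2_ge0 x; nra.
  exists x0; split=> // x Mx; have := Tmax _ Mx.
  by have := nrm2_ge0 (T x); have := nrm2_ge0 x0; nra.
have [|x0 [Mx0 x00 Tmax]] := maxT M.
  split=> //; apply: contrapT => nx; apply: M0; apply/seteqP; split=> x /=.
    by move=> Mx; apply: contrapT => x0; apply: nx; exists x.
  by move=> ->; exact: (subspace0 sM).
have [a a0 ax1] := normalize x00.
have Ma : M (a%:C *: x0) by exact: subspaceZ.
have a1 : unit_ball H (a%:C *: x0) by apply/norm_le1_nrm2; rewrite ax1.
have ub : ubound [set rnorm (T x) | x in M `&` unit_ball H] (rnorm (T (a%:C *: x0))).
  move=> _ [x [Mx /norm_le1_nrm2 x1] <-].
  rewrite !rnorm_sqrt ler_wsqrtr// bopZ nrm2Z; have := Tmax _ Mx; move: ax1.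
  rewrite nrm2Z; have := nrm2_gt0 x00; have := nrm2_ge0 (T x0).
  have : 0 < a ^+ 2 by rewrite exprn_even_gt0.
  move: (a ^+ 2) (nrm2 x0) (nrm2 (T x0)) (nrm2 (T x)) (nrm2 x) x1.
  move=> p n t tx nx nx1 p0 t0 n0 pn txn.
  rewrite -(ler_pM2r n0) (le_trans txn)// mulrAC pn mul1r.
  by rewrite -[leRHS]mulr1 ler_wpM2l.
exists (a%:C *: x0) => //; apply/eqP; rewrite eq_le; apply/andP; split.
  by apply: ub_le_sup; [exists (rnorm (T (a%:C *: x0)))|exists (a%:C *: x0)].
by apply: ge_sup => //; exists (rnorm (T (a%:C *: x0))), (a%:C *: x0).
Qed.

Lemma sequential_choice (X : choiceType) (good : X -> Prop) (step : seq X -> X -> Prop) :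
  (forall s, (forall u, u \in s -> good u) -> exists2 u, good u & step s u) ->
  exists z : nat -> X, forall n, good (z n) /\ step (mkseq z n) (z n).
Proof.
move=> ext; have [|f fP] := @choice (seq X) X
    (fun s u => (forall v, v \in s -> good v) -> good u /\ step s u).
  move=> s; have [sg|ns] := pselect (forall v, v \in s -> good v).
    by have [u gu su] := ext _ sg; exists u.
  by have [//|u _ _] := ext [::]; exists u.
pose L := fix L n := if n is m.+1 then rcons (L m) (f (L m)) else [::].
pose z n := f (L n).
have LE n : mkseq z n = L n by elim: n => [//|n IH]; rewrite mkseqS IH.
have Lg n : forall v, v \in L n -> good v.
  elim: n => [//|n IH] v; rewrite mem_rcons inE => /orP[/eqP->|/IH//].
  by have [] := fP _ IH.
by exists z => n; rewrite LE; exact: (fP _ (Lg n)).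
Qed.

(** The closed span of the [z_n], here [orth (orth (range z))], carries a vector
    [x0] maximizing [qform A / nrm2]. Its maximum [r] exceeds every quotient of
    the [z_n], so criticality, [inner ((r - A) x0) (z_n) = 0], together with
    [A z_n = a_n z_n] modulo the complement of the span, makes [x0] orthogonal
    to every [z_n]; thus [x0] is orthogonal to itself. *)
Lemma no_increasing_sequence T (z : nat -> H) : selfadjoint T ->
  has_maximizers T -> (forall n, z n <> 0) ->
  (forall m n, (m < n)%N -> [/\ inner (z n) (z m) = 0,
     inner (z n) ((T * T) (z m)) = 0 &
     qform (T * T) (z m) * nrm2 (z n) < qform (T * T) (z n) * nrm2 (z m)]) ->
  False.
Proof.
move=> sT maxT z0 zP; set A := T * T in zP.
have sA : selfadjoint A := selfadjoint_sqr sT.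
pose M := orth (orth (range z)).
have zM n : M (z n) by move=> y yz; rewrite innerC yz ?conjc0//; exists n.
have sM : subspace M := orth_subspace _.
have [|x0 [Mx0 x00 Tmax]] := maxT M.
  by split=> //; [exact: closed_orth|exists (z 0%N)].
have n0 := nrm2_gt0 x00; pose r := qform A x0 / nrm2 x0.
have rE : r * nrm2 x0 = qform A x0 by rewrite divfK// gt_eqF.
pose B := scal H r - A; have sB : selfadjoint B := selfadjointB (selfadjoint_scal _) sA.
have BE x : qform B x = r * nrm2 x - qform A x by rewrite qformB qform_scal.
have B0 x : M x -> 0 <= qform B x.
  move=> /Tmax; rewrite -!(qform_sqr _ sT) -/A -rE BE mulrAC ler_pM2r//.
  by rewrite subr_ge0.
have Bx0 : qform B x0 = 0 by rewrite BE rE subrr.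
have x0z n : inner x0 (z n) = 0.
  have zn := nrm2_gt0 (z0 n); pose a := qform A (z n) / nrm2 (z n).
  have aE : a * nrm2 (z n) = qform A (z n) by rewrite divfK// gt_eqF.
  have x0A : inner x0 (A (z n) - a%:C *: z n) = 0.
    apply: Mx0 => _ [m _ <-]; rewrite innerBl innerZl.
    have [nm|mn|<-] := ltngtP n m.
    - have [nz Az _] := zP _ _ nm.
      by rewrite innerC Az innerC nz !conjc0 mulr0 subrr.
    - have [nz Az _] := zP _ _ mn.
      by rewrite sA Az nz mulr0 subrr.
    - have ImA : complex.Im (inner (A (z n)) (z n)) = 0.
        by rewrite bop_mulE sT inner_nrm2.
      rewrite inner_nrm2 -rmorphM aE /qform /rip.
      by move: ImA; case: (inner _ _) => u v /= ->; rewrite subrr.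
  have := qform0_orth sM sB B0 Mx0 Bx0 (zM n).
  rewrite sB bop_addE bop_oppE scalE.
  have -> : r%:C *: z n - A (z n) = (r - a)%:C *: z n - (A (z n) - a%:C *: z n).
    by rewrite rmorphB scalerBl opprB addrA subrK.
  rewrite innerBr x0A subr0 innerZr conjc_real => /eqP.
  rewrite mulf_eq0 => /orP[|/eqP//]; rewrite eq_complex/= eqxx andbT => /eqP ra.
  have [_ _] := zP _ _ (ltnSn n); have := B0 _ (zM n.+1); rewrite BE.
  have -> : r = a by apply/eqP; rewrite -subr_eq0; exact/eqP.
  clear x0A; rewrite subr_ge0 => Ba; rewrite -aE => az.
  by move: az; rewrite mulrAC ltr_pM2r// ltNge Ba.
apply: x00; apply: nrm2_eq0; apply: inner0_rip; apply: Mx0 => _ [n _ <-].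
exact: x0z.
Qed.

(** Combining a vector with a small quotient and one with a large quotient,
    chosen orthogonal for both forms, realizes any quotient in between. *)
Lemma intermediate_quotient A G (a : R) : ~ finite_dimensional H -> selfadjoint A ->
  (forall G', exists2 x, perp G' x & qform A x < ess_upper A * nrm2 x) ->
  a < ess_upper A ->
  exists z, [/\ perp G z, a * nrm2 z < qform A z & qform A z < ess_upper A * nrm2 z].
Proof.
move=> infH sA low aq; set q := ess_upper A in low aq *.
have [x Gx xq] := low G.
have [xa|xa] := ltP (a * nrm2 x) (qform A x); first by exists x.
have x0 : 0 < nrm2 x.
  by apply: nrm2_gt0 => x0; move: xq; rewrite x0 qform0 nrm20 mulr0 ltxx.
pose b := (a + q) / 2; have ab : a < b by rewrite /b; lra.
have bq : b < q by rewrite /b; lra.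
have [y /perp_cons[yx /perp_cons[yAx Gy]] yb] :=
  ess_upper_gt infH (x :: A x :: G) bq.
(* [t] solves [qform A (x + t y) = b * nrm2 (x + t y)]; there are no cross terms. *)
pose t := Num.sqrt ((b * nrm2 x - qform A x) / (qform A y - b * nrm2 y)).
have t2 : t ^+ 2 * (qform A y - b * nrm2 y) = b * nrm2 x - qform A x.
  rewrite sqr_sqrtr ?divfK// ?gt_eqF//; first by lra.
  by apply: divr_ge0; nra.
have nE : nrm2 (x + t%:C *: y) = nrm2 x + t ^+ 2 * nrm2 y.
  by rewrite /nrm2 !ripE (ripC x y) (inner0_rip yx); lra.
have zE : qform A (x + t%:C *: y) = b * nrm2 (x + t%:C *: y).
  by rewrite qform_add// qformZ ripZr (ripC _ y) (inner0_rip yAx) nE; lra.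
have z0 : 0 < nrm2 (x + t%:C *: y).
  by rewrite nE ltr_wpDr// mulr_ge0 ?sqr_ge0 ?nrm2_ge0.
exists (x + t%:C *: y); split; last 2 first.
- by rewrite zE ltr_pM2r.
- by rewrite zE ltr_pM2r.
by apply: subspaceD (perp_subspace _) _ _ => //; exact: (subspaceZ _ (perp_subspace _)).
Qed.

(** If the form of [T^2] dipped below its upper essential bound on the complement
    of every finite set, orthogonal vectors with increasing quotients could be
    chosen one after the other. *)
Lemma maximizers_lower_bound T : ~ finite_dimensional H -> selfadjoint T ->
  has_maximizers T ->
  exists G, forall x, perp G x -> ess_upper (T * T) * nrm2 x <= qform (T * T) x.
Proof.
move=> infH sT maxT; set A := T * T; set q := ess_upper A.
have sA : selfadjoint A := selfadjoint_sqr sT.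
apply: contrapT => nG.
have low G : exists2 x, perp G x & qform A x < q * nrm2 x.
  apply: contrapT => nx; apply: nG; exists G => x Gx.
  by rewrite leNgt; apply/negP => xq; apply: nx; exists x.
pose good x := qform A x < q * nrm2 x.
have good0 x : good x -> x <> 0.
  by move=> + x0; rewrite /good x0 qform0 nrm20 mulr0 ltxx.
pose step s x := perp (s ++ map A s) x /\
  forall y, y \in s -> qform A y * nrm2 x < qform A x * nrm2 y.
have [s sg|z zP] := @sequential_choice H good step.
  (* [a] bounds the quotients of the vectors chosen so far. *)
  have [a aq sa] : exists2 a, a < q & forall y, y \in s -> qform A y <= a * nrm2 y.
    elim: s sg => [_|y s IH sg]; first by exists (q - 1) => //; lra.
    have [|a aq sa] := IH; first by move=> x xs; apply: sg; rewrite inE xs orbT.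
    have gy : good y by apply: sg; rewrite mem_head.
    have y0 := nrm2_gt0 (good0 _ gy).
    exists (Num.max a (qform A y / nrm2 y)).
      by rewrite gt_max aq ltr_pdivrMr.
    move=> x; rewrite inE => /orP[/eqP->|/sa xa].
      by rewrite -ler_pdivrMr// le_max lexx orbT.
    by apply: le_trans xa _; rewrite ler_wpM2r ?nrm2_ge0// le_max lexx.
  have [z [Gz az zq]] := intermediate_quotient (s ++ map A s) infH sA low aq.
  exists z => //; split=> // y ys; have yg := sg _ ys.
  have y0 := nrm2_gt0 (good0 _ yg); have z0 := nrm2_gt0 (good0 _ zq).
  by have := sa _ ys; nra.
apply: (@no_increasing_sequence T z sT maxT) => [n|m n mn].
  by apply: good0; have [] := zP n.
have [_ [/perp_cat[zn Azn] qn]] := zP n.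
have zmn : z m \in mkseq z n by apply/mapP; exists m; rewrite ?mem_iota.
by split; [exact: zn|apply: Azn; exact: map_f|exact: qn].
Qed.

End AttainingToSpectrum.

(** * Absolutely norm attaining operators are compact perturbations of scalars *)

Section CompactPerturbations.
Variables (R : realType) (H : hilbertType R).
Implicit Types (x y z g e : H) (S T K A B : bop H) (G : seq H) (M : set H).

(** [(T + a) (T - a) = T^2 - a^2], and [T + a] is bounded below by [a] because
    [T] is positive. *)
Lemma small_on_perps_root T (a : R) : selfadjoint T -> positive_op T -> 0 < a ->
  small_on_perps (T * T - scal H (a ^+ 2)) -> small_on_perps (T - scal H a).
Proof.
move=> sT pT a0 sA d d0; have a2 : 0 < a ^+ 2 by rewrite exprn_gt0.
have [|G GA] := sA (a ^+ 2 * d); first exact: mulr_gt0.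
exists G => x /GA xA; rewrite -(ler_pM2l a2) mulrA; apply: le_trans xA.
set y := (T - _) x.
have -> : (T * T - scal H (a ^+ 2)) x = T y + a%:C *: y.
  rewrite /y !(bop_addE, bop_oppE, bop_mulE, scalE) bopB bopZ scalerBr scalerA.
  by rewrite addrA subrK -rmorphM -expr2.
clearbody y; have : 0 <= qform T y by have := pT y; rewrite lecE => /andP[].
by rewrite /nrm2 !ripE (ripC y) /qform; have := nrm2_ge0 (T y); rewrite /nrm2; nra.
Qed.

(** On spaces of finite codimension the form of [T^2] lies between [q] and
    [q + d], where [q] is its upper essential bound; so [T^2 - q] is compact, and
    [a] is the square root of [q]. *)
Lemma has_maximizers_compact T : ~ finite_dimensional H -> positive_op T ->
  has_maximizers T -> exists a : R, [/\ 0 <= a, T - scal H a \in compact_op H &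
  exists G, forall x, perp G x -> a ^+ 2 * nrm2 x <= nrm2 (T x)].
Proof.
move=> infH pT maxT; have sT := positive_selfadjoint pT.
have sA := selfadjoint_sqr sT.
have [G GA] := maximizers_lower_bound infH sT maxT.
set q := ess_upper _ in GA.
have q0 : 0 <= q.
  apply/ler_addgt0Pr => d d0; have [G' G'A] := ess_upper_le infH (T * T) d0.
  have [x G'x x1] := perp_unit infH G'; have := G'A _ G'x.
  by rewrite x1 mulr1 qform_sqr//; exact: le_trans (nrm2_ge0 _).
have qE : Num.sqrt q ^+ 2 = q by rewrite sqr_sqrtr.
exists (Num.sqrt q); split; first exact: sqrtr_ge0.
  apply: small_on_perps_compact; have [q1|q1] := ltP 0 q.
    apply: small_on_perps_root => //; first by rewrite sqrtr_gt0.
    rewrite qE; apply: qform_small_on_perps => [|d d0].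
      exact: selfadjointB sA (selfadjoint_scal _).
    have [G' G'A] := ess_upper_le infH (T * T) d0.
    exists (G ++ G') => x /perp_cat[/GA Gx /G'A]; rewrite -/q => G'x.
    by rewrite qformB qform_scal ler_norml; apply/andP; split; lra.
  (* For [q = 0] the operator [T + a] is not bounded below, but the form of [T^2]
     controls [T] directly. *)
  have qq : q = 0 by apply/eqP; rewrite eq_le q1.
  rewrite qq sqrtr0 => d d0; have [G' G'A] := ess_upper_le infH (T * T) d0.
  exists G' => x /G'A; rewrite -/q qq add0r qform_sqr//.
  by rewrite bop_addE bop_oppE scalE scale0r subr0.
by exists G => x /GA; rewrite qE qform_sqr.
Qed.

(** * Spectrum below the essential spectrum *)

Lemma combination_in_perp n (e : 'I_n -> H) G : (size G < n)%N ->
  exists2 c : 'rV[R[i]]_n, c != 0 & perp G (\sum_i c 0 i *: e i).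
Proof.
move=> Gn; pose A : 'M[R[i]]_(n, size G) := \matrix_(i, j) inner (e i) G`_j.
have : kermx A != 0.
  rewrite -mxrank_eq0 mxrank_ker subn_eq0 -ltnNge.
  exact: leq_ltn_trans (rank_leq_col A) Gn.
move=> /rowV0Pn[c /sub_kermxP cA c0]; exists c => // g gG /=.
have iG : (index g G < size G)%N by rewrite index_mem.
have := congr1 (fun B : 'rV_(size G) => B 0 (Ordinal iG)) cA.
rewrite !mxE => cA0; rewrite inner_suml -[RHS]cA0.
by apply: eq_bigr => i _; rewrite mxE/= nth_index.
Qed.

Lemma bop_sum S n (f : 'I_n -> H) : S (\sum_i f i) = \sum_i S (f i).
Proof. exact: raddf_sum. Qed.

(** A combination of eigenvectors with eigenvalues between [0] and [a] violates the
    lower bound [a |x| <= |T x|], so at most [size G] such eigenvalues exist. *)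
Lemma finite_spectrum_below T (a : R) G : positive_op T ->
  T - scal H a \in compact_op H ->
  (forall x, perp G x -> a ^+ 2 * nrm2 x <= nrm2 (T x)) ->
  finite_set (op_spectrum T `&` [set l | l < a%:C]).
Proof.
move=> pT cT GT; have sT := positive_selfadjoint pT.
apply: contrapT => /(infinite_set_fset (size G).+1)[F FT Fn].
have Fe l : l \in F -> exists x, [/\ x <> 0, l = (complex.Re l)%:C,
    T x = l *: x & 0 <= complex.Re l < a].
  move=> lF; have [Tl /= la] := FT l lF.
  move: la; rewrite ltcE /= => /andP[/eqP l0 la].
  have lE : l = (complex.Re l)%:C.
    by apply/eqP; rewrite eq_complex/= eqxx -l0 eqxx.
  have [||x x0 Tx] := @op_spectrum_eigenvalue R H T a (complex.Re l) sT cT.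
  - by rewrite lt_eqF.
  - by rewrite -lE.
  exists x; rewrite -lE in Tx; split=> //; rewrite la andbT.
  have := pT x; rewrite Tx innerZl inner_nrm2 lE -rmorphM ler0c.
  by rewrite pmulr_lge0// nrm2_gt0.
have [|e eP] := @choice R[i] H (fun l x => l \in F -> [/\ x <> 0,
    l = (complex.Re l)%:C, T x = l *: x & 0 <= complex.Re l < a]).
  move=> l; have [/Fe[x xP]|lF] := boolP (l \in F); first by exists x.
  by exists 0.
pose s := enum_fset F; pose l (i : 'I_(size s)) := s`_i.
have lF i : l i \in F by exact: mem_nth.
have [|c c0 Gc] := @combination_in_perp (size s) (fun i => e (l i)) G.
  exact: Fn.
set x := \sum_i _ in Gc.
have orth_e i j : i != j -> inner (e (l i)) (e (l j)) = 0.
  move=> ij; have [_ _ Ti _] := eP _ (lF i); have [_ jR Tj _] := eP _ (lF j).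
  have := sT (e (l i)) (e (l j)); rewrite Ti Tj innerZl innerZr jR conjc_real -jR.
  move=> /eqP; rewrite -subr_eq0 -mulrBl mulf_eq0 subr_eq0 => /orP[|/eqP//].
  by rewrite nth_uniq ?fset_uniq// -[_ == _]/(i == j) (negbTE ij).
have ex i : inner (e (l i)) x = conjc (c 0 i) * (nrm2 (e (l i)))%:C.
  rewrite innerC inner_suml (bigD1 i)//= big1 ?addr0; last first.
    by move=> j ji; rewrite orth_e// mulr0.
  rewrite inner_nrm2 -[in RHS](conjc_real (nrm2 _)).
  exact: (rmorphM (@conjc R)).
pose B := scal H (a ^+ 2) - T * T.
pose t i : R := (a ^+ 2 - complex.Re (l i) ^+ 2) * nrm2 (e (l i)).
have t0 i : 0 < t i.
  have [/nrm2_gt0 ei _ _ /andP[li0 lia]] := eP _ (lF i).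
  by rewrite mulr_gt0// subr_gt0 ltr_pXn2r ?nnegrE//; lra.
have BxE : inner (B x) x = \sum_i `|c 0 i| ^+ 2 * (t i)%:C.
  have -> : B x = \sum_i c 0 i *: ((a ^+ 2 - complex.Re (l i) ^+ 2)%:C *: e (l i)).
    rewrite bop_sum; apply: eq_bigr => i _; rewrite bopZ; congr (_ *: _).
    have [_ liR Ti _] := eP _ (lF i).
    rewrite !(bop_addE, bop_oppE, bop_mulE, scalE) Ti bopZ Ti scalerA rmorphB scalerBl.
    by have -> : l i * l i = (complex.Re (l i) ^+ 2)%:C
      by rewrite {1 2}liR -rmorphM -expr2.
  rewrite inner_suml; apply: eq_bigr => i _; rewrite innerZl ex.
  by rewrite sqr_normc /t rmorphM/=; ring.
have term0 i : 0 <= `|c 0 i| ^+ 2 * (t i)%:C.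
  by rewrite mulr_ge0 ?exprn_ge0// ler0c ltW.
(* The sum has nonnegative terms, but [x] is in [perp G], so all of them vanish. *)
have Bx0 : 0 <= inner (B x) x by rewrite BxE sumr_ge0.
have {}Bx0 : inner (B x) x = 0.
  have : qform B x <= 0.
    by rewrite qformB qform_scal qform_sqr// subr_le0; exact: GT.
  move: Bx0; rewrite /qform /rip; case: (inner _ _) => u v.
  rewrite lecE/= => /andP[/eqP-> u0] u1.
  by congr Complex; apply/eqP; rewrite eq_le u1.
move: c0 => /negP; apply; apply/eqP/rowP => i; rewrite mxE.
rewrite BxE in Bx0; have /(_ i isT)/eqP := psumr_eq0P (fun i _ => term0 i) Bx0.
have ti : 0 < (t i)%:C by rewrite ltcR.
by rewrite mulf_eq0 sqrf_eq0 normr_eq0 (gt_eqF ti) orbF => /eqP.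
Qed.

(** * Compact perturbations of scalars attain their norms *)

(** For a unit vector [x] of the eigenspace, [(T - a) x = (l - a) x]. If [x] is
    orthogonal to a net, this vector keeps the distance [|l - a|] from all points
    of the net; so the eigenspace meets the complement of a finer net trivially. *)
Lemma eigenspace_span T (a l : R) : T - scal H a \in compact_op H -> l != a ->
  exists t : seq H, perp t `<=` orth [set x | T x = l%:C *: x].
Proof.
move=> cT la; have d0 : 0 < (l - a) ^+ 2 by rewrite exprn_even_gt0//= subr_eq0.
have [G GT] := compact_op_nets cT d0.
pose E := [set x | T x = l%:C *: x].
have sE : subspace E.
  apply/subspaceP; split=> [|b x y]; rewrite /E/= ?bop0 ?scaler0// => Tx Ty.
  by rewrite bopD bopZ Tx Ty scalerDr !scalerA mulrC.
have [|s [_ Es]] := @finite_span R H G E sE; last first.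
  by exists s => x sx; exact: finite_span_orth Es sx.
move=> x Ex Gx; apply: contrapT => /normalize[b b0 x1].
set y := b%:C *: x in x1.
have Ey : E y by exact: subspaceZ.
have Gy : perp G y by exact: (subspaceZ _ (perp_subspace G)).
clearbody y; have [|g gG] := GT y; first by rewrite x1.
rewrite bop_addE bop_oppE scalE Ey -scalerBl -rmorphB ltNge => /negP; apply.
rewrite /nrm2 !ripE (ripC g y) (inner0_rip (Gy _ gG)) -!/(nrm2 _) x1.
by have := nrm2_ge0 g; lra.
Qed.

Lemma eigenspaces_span T (a : R) (s : seq R) : T - scal H a \in compact_op H ->
  (forall l, l \in s -> l < a) ->
  exists t : seq H, forall x l, perp t x -> l \in s -> orth [set y | T y = l%:C *: y] x.
Proof.
move=> cT; elim: s => [_|l s IH ls]; first by exists [::].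
have [|t tP] := IH; first by move=> m ms; apply: ls; rewrite inE ms orbT.
have [|t' t'P] := eigenspace_span (l := l) cT; first by rewrite lt_eqF// ls// mem_head.
exists (t ++ t') => x m /perp_cat[tx t'x]; rewrite inE => /orP[/eqP->|ms].
  exact: t'P.
exact: tP.
Qed.

(** On the complement of all eigenvectors below [a] the compact operator [a - T]
    has no positive maximum of its form, since the maximizer would be one more
    eigenvector. *)
Lemma qform_ge_on_perp T (a : R) : selfadjoint T -> T - scal H a \in compact_op H ->
  finite_set (op_spectrum T `&` [set l | l < a%:C]) ->
  exists G, forall x, perp G x -> a * nrm2 x <= qform T x.
Proof.
move=> sT cT /finite_seqP[s sP].
have [t tP] : exists t : seq H, forall x l, perp t x ->
    l \in [seq complex.Re l | l <- s] -> orth [set y | T y = l%:C *: y] x.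
  apply: (eigenspaces_span cT) => l /mapP[m ms ->].
  have : [set` s] m by [].
  by rewrite -sP => -[_ /=]; rewrite ltcE => /andP[].
pose D := [set y | exists2 l : R, l < a & T y = l%:C *: y].
have sD : subspace (orth D) := orth_subspace D.
have DT x : orth D x -> orth D (T x).
  by move=> Dx y [l la Ty]; rewrite sT Ty innerZr Dx ?mulr0//; exists l.
pose K := scal H a - T.
have sK : selfadjoint K := selfadjointB (selfadjoint_scal _) sT.
have cK : K \in compact_op H.
  by rewrite /K -opprB rpredN.
exists t => x tx.
have Dx : orth D x.
  move=> y [l la Ty]; have [->|y0] := pselect (y = 0); first exact: inner0r.
  apply: (tP x l tx _ y Ty); have : (op_spectrum T `&` [set l | l < a%:C]) l%:C.
    by split; [exact: eigenvalue_op_spectrum y0 Ty|rewrite /= ltcR].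
  by rewrite sP /= => ls; apply/mapP; exists l%:C.
rewrite leNgt; apply/negP => xa; have Kx : 0 < qform K x.
  by rewrite qformB qform_scal subr_gt0.
have [x0 [Dx0 x00 Kmax]] := compact_maximizer sK cK sD (@closed_orth R H D) Dx Kx.
have n0 := nrm2_gt0 x00; pose b := qform K x0 / nrm2 x0.
have bE : b * nrm2 x0 = qform K x0 by rewrite divfK// gt_eqF.
have b0 : 0 < b.
  by have := Kmax _ Dx; rewrite -bE mulrAC ler_pM2r//; have := nrm2_ge0 x; nra.
pose B := scal H b - K.
have sB : selfadjoint B := selfadjointB (selfadjoint_scal _) sK.
have BE y : qform B y = b * nrm2 y - qform K y by rewrite qformB qform_scal.
have BD y : orth D y -> 0 <= qform B y.
  by move=> /Kmax; rewrite -bE mulrAC ler_pM2r// BE subr_ge0.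
have Bx0 : qform B x0 = 0 by rewrite BE bE subrr.
have DB : orth D (B x0).
  apply: (subspaceB sD (subspaceZ _ sD Dx0)).
  exact: (subspaceB sD (subspaceZ _ sD Dx0) (DT _ Dx0)).
have /inner0_rip/nrm2_eq0 Bx00 := qform0_orth sD sB BD Dx0 Bx0 DB.
apply: x00; apply: nrm2_eq0; apply: inner0_rip; apply: Dx0.
exists (a - b); first by rewrite ltrBlDr ltrDl.
apply/eqP; rewrite -subr_eq0 -Bx00 !(bop_addE, bop_oppE, scalE) rmorphB scalerBl.
by rewrite !opprB addrCA.
Qed.

(** A unit vector orthogonal to a fine net of the image of the unit ball under
    [T - a] has [qform T x] close to [a]. *)
Lemma compact_perturbation_ge0 T (a : R) : ~ finite_dimensional H -> positive_op T ->
  T - scal H a \in compact_op H -> 0 <= a.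
Proof.
move=> infH pT cT; rewrite leNgt; apply/negP => a0.
have [|G GT] := compact_op_nets cT (e := a ^+ 2); first by nra.
have [x Gx x1] := perp_unit infH G; have [|g gG gx] := GT x; first by rewrite x1.
have Tx : 0 <= qform T x by have := pT x; rewrite lecE => /andP[].
have := rip_cauchy_schwarz (g - (T - scal H a) x) x; rewrite x1 mulr1.
rewrite {1}ripDl ripC (inner0_rip (Gx _ gG)) add0r ripNl -/(qform _ x).
by rewrite qformB qform_scal x1; nra.
Qed.

(** If [M] meets [perp G], the supremum of [nrm2 (T x) / nrm2 x] on [M] is at
    least [a ^+ 2]: either it equals [a ^+ 2] and is attained at the common vector,
    or the compact operator [T^2 - a^2] has a positive form somewhere on [M].
    Otherwise [M] is finite dimensional, and on [M] the form of [T^2 + 1] agrees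
    with that of a compact operator. *)
Lemma compact_perturbation_has_maximizers T (a : R) G : 0 <= a -> selfadjoint T ->
  T - scal H a \in compact_op H ->
  (forall x, perp G x -> a * nrm2 x <= qform T x) -> has_maximizers T.
Proof.
move=> a0 sT cT GT M [sM cM [y My y0]].
have sA := selfadjoint_sqr sT.
have [[x [Mx x0 Gx]]|MG] := pselect (exists x, [/\ M x, x <> 0 & perp G x]).
  have xT : a ^+ 2 * nrm2 x <= nrm2 (T x).
    have := rip_cauchy_schwarz (T x) x; rewrite -/(qform T x).
    have := GT _ Gx; have := nrm2_gt0 x0; move: (qform T x) (nrm2 x) => q n n0 qn h.
    rewrite -(ler_pM2r n0); apply: le_trans h.
    have : 0 <= a * n by rewrite mulr_ge0// ltW.
    by nra.
  pose K := T * T - scal H (a ^+ 2).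
  have KE z : qform K z = nrm2 (T z) - a ^+ 2 * nrm2 z.
    by rewrite qformB qform_scal qform_sqr.
  have sK : selfadjoint K := selfadjointB sA (selfadjoint_scal _).
  have [[x1 [Mx1 Kx1]]|nK] := pselect (exists x1, M x1 /\ 0 < qform K x1); last first.
    exists x; split=> // z Mz; have zT : nrm2 (T z) <= a ^+ 2 * nrm2 z.
      by rewrite leNgt; apply/negP => Kz; apply: nK; exists z; rewrite KE subr_gt0.
    by have := nrm2_ge0 z; have := nrm2_ge0 x; nra.
  have cK : K \in compact_op H.
    have -> : K = (T - scal H a) * (T + scal H a); last exact: compact_opMr.
    have comm : T * scal H a = scal H a * T.
      by apply: bopP => z; rewrite !bop_mulE !scalE bopZ.
    rewrite mulrBl !mulrDr comm opprD addrA addrK.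
    by rewrite /K expr2 /scal !rmorphM.
  have [x2 [Mx2 x20 Kmax]] := compact_maximizer sK cK sM cM Mx1 Kx1.
  by exists x2; split=> // z /Kmax; rewrite !KE; lra.
have [|s [_ sP]] := @finite_span R H G M sM.
  by move=> x Mx Gx; apply: contrapT => x0; apply: MG; exists x.
have [P [sP' PP Ps _ cP]] := perp_projection s.
have PM x : M x -> (1 - P) x = x.
  move=> Mx; rewrite bop_addE bop_oppE bop_oneE; suff -> : P x = 0 by rewrite subr0.
  apply: nrm2_eq0; rewrite /nrm2 selfadjoint_rip// PP ripC.
  exact: inner0_rip (finite_span_orth sP (Ps x) Mx).
have sC : selfadjoint (1 - P) := selfadjointB (@selfadjoint1 R H) sP'.
(* The summand 1 makes the form positive on [M] even where [T] vanishes; it shifts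
   all quotients by the same amount. *)
pose K := (1 - P) * (T * T + 1) * (1 - P).
have sK : selfadjoint K.
  move=> x z; rewrite !bop_mulE sC (selfadjointD sA (@selfadjoint1 R H)).
  by rewrite sC.
have cK : K \in compact_op H by exact: compact_opM.
have KE x : M x -> qform K x = nrm2 (T x) + nrm2 x.
  move=> Mx; rewrite /qform !bop_mulE selfadjoint_rip// !PM// -/(qform _ x).
  by rewrite qformD qform_sqr.
have [|x2 [Mx2 x20 Kmax]] := compact_maximizer sK cK sM cM My.
  by rewrite KE//; have := nrm2_gt0 y0; have := nrm2_ge0 (T y); lra.
by exists x2; split=> // z Mz; have := Kmax _ Mz; rewrite !KE//; lra.
Qed.

End CompactPerturbations.

Theorem theorem2 (R : realType) (H : hilbertType R) (T : bop H)
    (infH : ~ finite_dimensional H) (posT : positive_op T) :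
  absolutely_norm_attaining T <->
  exists alpha : R[i],
    ess_spectrum T = [set alpha] /\
    finite_set (op_spectrum T `&` [set l | l < alpha]).
Proof.
have sT := positive_selfadjoint posT.
split=> [/absolutely_norm_attainingP maxT|[alpha [essT finT]]].
  have [a [a0 cT [G GT]]] := has_maximizers_compact infH posT maxT.
  exists a%:C; split; first exact: ess_spectrum_compact.
  exact: finite_spectrum_below GT.
apply/absolutely_norm_attainingP.
have [a aE cT] := ess_spectrum1_compact infH sT essT; rewrite aE in finT.
have [G GT] := qform_ge_on_perp sT cT finT.
have a0 := compact_perturbation_ge0 infH posT cT.
exact: compact_perturbation_has_maximizers a0 sT cT GT.
Qed.
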